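(* Let $S$ be a Damek--Ricci space and let $k\ge1$ be an integer. There exists a constant $C_k>0$ such that, for all $J\in\{0,\dots,n-1\}^k$, $$|\mathbb{X}_J r|\le C_k\Big(\frac{1+r}{r}\Big)^{k-1}$$ at every point of $S\setminus\{e\}$.
   Context: Damek--Ricci space. Let $\nu\ge1$ and $\mu\ge0$ be integers and let $z\mapsto J_z$ be a linear map from $\mathbb{R}^\nu$ to skew-symmetric $\mu\times\mu$ real matrices such that $J_z$ is orthogonal whenever $|z|=1$ (so $\mu$ is even; the degenerate case $\mu=0$, where the variable $x$ is absent, is allowed). Let $(e_\ell)$, $(u_k)$ be the standard bases of $\mathbb{R}^\mu$, $\mathbb{R}^\nu$. $S=\mathbb{R}^\mu\times\mathbb{R}^\nu\times\mathbb{R}^+$ is the group with law $(x,z,a)(x',z',a')=\big(x+\sqrt a\,x',\,z+az'+\tfrac12\sqrt a\sum_{k=1}^\nu(J_{u_k}x,x')u_k,\,aa'\big)$ and identity $e=(0,0,1)$. Set $n=\mu+\nu+1=\dim S$. Left-invariant vector fields: $\mathbb{X}_0=a\partial_a$, $\mathbb{X}_\ell=\sqrt a\big(\partial_{x_\ell}+\tfrac12\sum_{k=1}^\nu(J_{u_k}x,e_\ell)\partial_{z_k}\big)$ for $1\le\ell\le\mu$, $\mathbb{X}_{\mu+k}=a\,\partial_{z_k}$ for $1\le k\le\nu$. $S$ carries the left-invariant Riemannian metric for which $\mathbb{X}_0,\dots,\mathbb{X}_{n-1}$ are orthonormal; $d$ is the Riemannian distance and $r=r(x,z,a)=d((x,z,a),e)$.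 It is known that $\cosh r=-1+2\big(\tfrac{a^{1/2}+a^{-1/2}}2+\tfrac18a^{-1/2}|x|^2\big)^2+\tfrac12a^{-1}|z|^2$. For $J=(J_1,\dots,J_k)\in\{0,\dots,n-1\}^k$, $\mathbb{X}_J=\mathbb{X}_{J_1}\cdots\mathbb{X}_{J_k}$. *)

(* Defs.v *)
From HB Require Import structures.
From mathcomp Require Import all_boot all_order all_algebra.
From mathcomp Require Import all_classical all_reals all_analysis.

Set Implicit Arguments.
Unset Strict Implicit.
Unset Printing Implicit Defensive.

Import Order.TTheory GRing.Theory Num.Theory.
Import numFieldNormedType.Exports.

Local Open Scope classical_set_scope.
Local Open Scope ring_scope.

(* Ambient space of S, and tangent space of S at each of its points.
   The point (x, z, a) is p with p.1.1 = x, p.1.2 = z, p.2 = a. *)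
Notation ambient R mu nu := ('cV[R]_mu * 'cV[R]_nu * R)%type.

Section DamekRicci.
Context {R : realType}.

(* The library norm `|u| on matrices is the sup norm, hence a separate
   Euclidean product and norm. *)
Definition dotp n (u v : 'cV[R]_n) : R := \sum_i u i 0 * v i 0.

Definition enorm n (u : 'cV[R]_n) : R := Num.sqrt (dotp u u).

Section Space.
Variables (mu nu : nat) (J : 'cV[R]_nu -> 'M[R]_mu).

Local Notation DR := (ambient R mu nu).

Definition DRset : set DR := [set p | 0 < p.2].

(* \sum_k (J_{u_k} x, y) u_k, where u_k = delta_mx k 0 *)
Definition bracket (x y : 'cV[R]_mu) : 'cV[R]_nu :=
  \col_k dotp (J (delta_mx k 0) *m x) y.

Definition DRmul (p q : DR) : DR :=
  (p.1.1 + Num.sqrt p.2 *: q.1.1,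
   p.1.2 + p.2 *: q.1.2 + (2^-1 * Num.sqrt p.2) *: bracket p.1.1 q.1.1,
   p.2 * q.2).

Definition DRone : DR := (0, 0, 1).

(* n = mu + nu + 1 vector fields: index 0 is a d/da, the next mu indices are
   those of x, the last nu ones those of z. *)
Definition frame (i : 'I_(1 + (mu + nu))) (p : DR) : DR :=
  match fintype.split i with
  | inl _ => (0, 0, p.2)
  | inr j =>
    match fintype.split j with
    | inl l => (Num.sqrt p.2 *: delta_mx l 0,
                (2^-1 * Num.sqrt p.2) *: bracket p.1.1 (delta_mx l 0), 0)
    | inr k => (0, p.2 *: delta_mx k 0, 0)
    end
  end.

(* i-th coordinate of the tangent vector v at p in the basis (frame j p)_j;
   see coframe_frame *)
Definition coframe (i : 'I_(1 + (mu + nu))) (p v : DR) : R :=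
  match fintype.split i with
  | inl _ => v.2 / p.2
  | inr j =>
    match fintype.split j with
    | inl l => v.1.1 l 0 / Num.sqrt p.2
    | inr k => (v.1.2 - 2^-1 *: bracket p.1.1 v.1.1) k 0 / p.2
    end
  end.

(* The Riemannian metric for which the frame is orthonormal *)
Definition metric (p v w : DR) : R :=
  \sum_i coframe i p v * coframe i p w.

Definition speed (g : R -> DR) (t : R) : R :=
  Num.sqrt (metric (g t) ('D_1 g t) ('D_1 g t)).

(* A C^1 arc on [0, 1] with one-sided derivatives at the end points extends to
   a C^1 map on the line, so asking for regularity on the line is harmless. *)
Definition C1_arc (g : R -> DR) : Prop :=
  [/\ forall t, derivable g t 1, continuous (fun t => 'D_1 g t) &
      forall t, 0 <= t <= 1 -> DRset (g t)].

Definition arc_length (g : R -> DR) : R :=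
  \int[lebesgue_measure]_(t in `[0, 1]) speed g t.

(* joined p q l : some piecewise C^1 curve in S of length l goes from p to q *)
Inductive joined : DR -> DR -> R -> Prop :=
| joined_arc g : C1_arc g -> joined (g 0) (g 1) (arc_length g)
| joined_cat p q s l m :
    joined p q l -> joined q s m -> joined p s (l + m).

Definition DRdist (p q : DR) : R := inf [set l | joined p q l].

Definition DRr (p : DR) : R := DRdist p DRone.

Definition frame_derive (i : 'I_(1 + (mu + nu))) (f : DR -> R) (p : DR) : R :=
  'D_(frame i p) f p.

(* frame_derives [:: J_1; ..; J_k] f = X_{J_1} (.. (X_{J_k} f)) *)
Definition frame_derives (s : seq 'I_(1 + (mu + nu))) (f : DR -> R) : DR -> R :=
  foldr frame_derive f s.

End Space.

Section Facts.
Variables (mu nu : nat) (J : 'cV[R]_nu -> 'M[R]_mu).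

Local Notation DR := (ambient R mu nu).

Lemma bracketE x y k :
  bracket J x y k 0 = \sum_i (J (delta_mx k 0) *m x) i 0 * y i 0.
Proof. by rewrite /bracket mxE. Qed.

Lemma bracketD x y z : bracket J x (y + z) = bracket J x y + bracket J x z.
Proof.
apply/colP => k; rewrite [RHS]mxE !bracketE -big_split /=.
by apply: eq_bigr => i _; rewrite -mulrDr; congr (_ * _); rewrite mxE.
Qed.

Lemma bracketZ x c y : bracket J x (c *: y) = c *: bracket J x y.
Proof.
apply/colP => k; rewrite [RHS]mxE !bracketE mulr_sumr.
by apply: eq_bigr => i _; rewrite mulrCA; congr (_ * _); rewrite mxE.
Qed.

Lemma bracket0 x : bracket J x 0 = 0.
Proof. by rewrite -(scale0r 0) bracketZ scale0r. Qed.

Lemma coframe_frame (p : DR) i j : DRset p ->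
  coframe J i p (frame J j p) = (i == j)%:R.
Proof.
move=> p0; have p20 : p.2 != 0 by rewrite gt_eqF.
have sp0 : Num.sqrt p.2 != 0 by rewrite sqrtr_eq0 -ltNge.
rewrite /coframe /frame -[i]splitK -[j]splitK !unsplitK.
case: (fintype.split i) => [i0|i1]; case: (fintype.split j) => [j0|j1] /=.
- by rewrite (ord1 i0) (ord1 j0) eqxx divff.
- by rewrite eq_lrshift; case: (fintype.split j1) => ? /=; rewrite mul0r.
- rewrite eq_rlshift; case: (fintype.split i1) => ? /=.
    by rewrite mxE mul0r.
  by rewrite bracket0 scaler0 subr0 mxE mul0r.
- rewrite eq_rshift -[i1]splitK -[j1]splitK !unsplitK.
  case: (fintype.split i1) => i2; case: (fintype.split j1) => j2 /=.
  + by rewrite eq_lshift !mxE andbT mulrC mulKf.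
  + by rewrite eq_lrshift mxE mul0r.
  + by rewrite eq_rlshift bracketZ scalerA subrr mxE mul0r.
  + rewrite eq_rshift bracket0 scaler0 subr0 !mxE andbT.
    by rewrite mulrC mulKf.
Qed.

Lemma metric_frame (p : DR) i j : DRset p ->
  metric J p (frame J i p) (frame J j p) = (i == j)%:R.
Proof.
move=> p0; rewrite /metric (bigD1 i)//= !coframe_frame// eqxx mul1r.
rewrite big1 ?addr0// => k ki.
by rewrite coframe_frame// (negbTE ki) mul0r.
Qed.

Lemma bracket0l y : bracket J 0 y = 0.
Proof.
apply/colP => k; rewrite bracketE [RHS]mxE big1// => i _.
by rewrite mulmx0 mxE mul0r.
Qed.

Lemma DRmul_sub (p v : DR) h :
  DRmul J p (h *: v + DRone mu nu) - DRmul J p (DRone mu nu) =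
  h *: (Num.sqrt p.2 *: v.1.1,
        p.2 *: v.1.2 + (2^-1 * Num.sqrt p.2) *: bracket J p.1.1 v.1.1,
        p.2 * v.2).
Proof.
rewrite /DRmul /= !scaler0 !addr0 bracket0 bracketZ scaler0 !addr0 mulr1.
congr ((_, _), _) => /=.
- by rewrite [LHS]addrC addKr scalerA mulrC -scalerA.
- rewrite -[X in X - _]addrA [LHS]addrC addKr scalerDr !scalerA; congr (_ *: _ + _ *: _).
    by rewrite mulrC.
  by rewrite mulrC.
- by rewrite mulrDr mulr1 addrK mulrCA.
Qed.

Lemma frame_left_invariant (p : DR) i :
  'D_(frame J i (DRone mu nu)) (DRmul J p) (DRone mu nu) = frame J i p.
Proof.
rewrite /derive; apply: lim_near_cst => //; near=> h.
have h0 : h != 0 by near: h; exact: nbhs_dnbhs_neq.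
rewrite DRmul_sub scalerA mulVf// scale1r /frame.
case: (fintype.split i) => [i0|j] /=.
  by rewrite bracket0 !scaler0 addr0 mulr1.
case: (fintype.split j) => l /=.
  by rewrite sqrtr1 scale1r bracket0l !scaler0 add0r mulr0.
by rewrite bracket0 !scaler0 addr0 mulr0 scale1r.
Unshelve. all: by end_near.
Qed.

End Facts.
End DamekRicci.

(* Main.v *)
Require Import Defs.
From HB Require Import structures.
From mathcomp Require Import all_boot all_order all_algebra.
From mathcomp Require Import all_classical all_reals all_analysis.
From mathcomp Require Import ring lra.
Import Order.TTheory GRing.Theory Num.Theory.
Import numFieldNormedType.Exports.

Set Implicit Arguments.
Unset Strict Implicit.
Unset Printing Implicit Defensive.

Local Open Scope classical_set_scope.
Local Open Scope ring_scope.

(** The derivatives X_J r are governed by the function F = cosh r, which is an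
    explicit polynomial in x, z, a^(1/2) and a^(-1/2).  Write s = sinh r, that
    is s^2 = F^2 - 1.

    Bounds.  The span of the functions a^(1/2), a^(-1/2), x_i,
    x_i x_j a^(-1/2), z_k a^(-1/2) is stable under right translations of the
    group, hence under the left-invariant fields X_i, and each of its elements
    is O(F^(1/2)).  Since F is a sum of products of two such functions, all the
    iterated derivatives X_J F belong to a space whose elements are O(F) on the
    whole of S, however far from the identity [order_one_frame_derive,
    order_one_bound].  Off the identity X_i r = X_i F / s, and the quotient rule
    reads X_i (f / s) = X_i f / s - (f / s) (F / s) (X_i F / s).  The functions
    X_i F / s are bounded because r has a gradient of norm 1, and f / s is
    O(F / s) for f in the space above.  So X_i r is a symbol of order 0, each
    further derivation costs at most one factor F / s = coth r
    [symbol_frame_derive, symbol_bound], and coth r <= (1 + r) / r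
    [coth_dist_le].

    Distance.  As r is the infimum of the lengths of curves, the formula for
    cosh r has to be proved [DRrE].  The identity
    sum_i (X_i F)^2 = F^2 - 1 [gradient_cosh_dist], a consequence of J_z being
    skew and a multiple of an isometry, says that arcosh F has a gradient of
    norm 1; so no curve from p to the identity is shorter than arcosh F(p)
    [dist_formula_joined].  Conversely the geodesic from p to the identity lies
    in the complex hyperbolic plane spanned by x, J_z x, z and a.  The Cayley
    transform carries this plane to a ball in which geodesics through the image
    of the identity are straight rays; transporting the ray back gives an
    explicit rational curve of length arcosh F(p) [joined_dist_formula]. *)

(** * Differential calculus *)

(** Differentiability is local: the difference of the two functions vanishes
    near p, so it has the zero map as differential. *)
Lemma near_differentiable (R : realType) (V W : normedModType R)
    (f g : V -> W) (p : V) :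
  (\near p, f p = g p) -> differentiable f p -> differentiable g p.
Proof.
move=> fg df; have -> : g = f + (g - f) by rewrite addrC subrK.
apply: differentiableD => //.
have h0 : \forall q \near p, (g - f) q = 0.
  by apply: filterS fg => q e; rewrite !fctE e subrr.
set h := g - f in h0 *.
have hp : h p = 0 by exact: nbhs_singleton h0.
have E : h \o shift p = cst (h p) + \0 +o_ 0 id.
  apply/eqaddoP => e e0 /=; rewrite hp.
  have : \forall k \near (0 : V), h (k + p) = 0.
    by move: h0; rewrite (near_shift 0) subr0.
  by apply: filterS => k hk; rewrite !fctE /= hk addr0 subrr normr0 mulr_ge0// ltW.
have D := diff_unique (f := h) (df := \0) (x := p) _ E.
apply/diff_locallyP; rewrite D //; last exact: cst_continuous.
by split=> //; exact: cst_continuous.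
Qed.

Section Calculus.
Context {R : realType} {V : normedModType R}.
Implicit Types (f g : V -> R) (p v : V).

Lemma is_derive_fM f g p v (df dg : R) : is_derive p v f df -> is_derive p v g dg ->
  is_derive p v (fun p => f p * g p) (f p * dg + g p * df).
Proof. exact: is_deriveM. Qed.

Lemma is_derive_fD f g p v (df dg : R) : is_derive p v f df -> is_derive p v g dg ->
  is_derive p v (fun p => f p + g p) (df + dg).
Proof. exact: is_deriveD. Qed.

Lemma is_derive_fV f p v (df : R) : f p != 0 -> is_derive p v f df ->
  is_derive p v (fun s => (f s)^-1) (- df / f p ^+ 2).
Proof.
move=> f0 Df; apply: DeriveDef; first by apply: derivableV.
by rewrite deriveV// derive_val /GRing.scale/= mulNr mulrC mulNr.
Qed.

(** Differentiability of f, rather than the mere existence of the derivative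
    along v, is what makes h \o f differentiable along v. *)
Lemma is_derive_comp1 (h : R -> R) f p v (dh df : R) :
  differentiable f p -> is_derive (f p) 1 h dh -> is_derive p v f df ->
  is_derive p v (h \o f) (dh * df).
Proof.
move=> Df [dh1 dh2] [df1 df2].
have Dh : differentiable h (f p) by apply/derivable1_diffP.
apply: DeriveDef; first exact/diff_derivable/differentiable_comp.
rewrite deriveE; last exact: differentiable_comp.
rewrite diff_comp//= deriv1E//= derive1E dh2 -deriveE//.
by rewrite [LHS]mulrC; congr (_ * _); exact: df2.
Qed.

Lemma differentiable_sqrt_comp f p : differentiable f p -> 0 < f p ->
  differentiable (fun q => Num.sqrt (f q)) p.
Proof.
move=> df f0; apply: (@differentiable_comp _ _ _ _ f Num.sqrt) => //.
by apply/derivable1_diffP; apply: ex_derive; exact: is_derive1_sqrt.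
Qed.

Lemma differentiable_ln_comp f p : differentiable f p -> 0 < f p ->
  differentiable (fun q => ln (f q)) p.
Proof.
move=> df f0; apply: (@differentiable_comp _ _ _ _ f (@ln R)) => //.
by apply/derivable1_diffP; apply: ex_derive; exact: is_derive1_ln.
Qed.

End Calculus.

Section Curves.
Context {R : realType}.
Implicit Types (f h : R -> R) (t : R).

Lemma derivable_continuous1 (V : normedModType R) (g : R -> V) t :
  derivable g t 1 -> {for t, continuous g}.
Proof. by move/derivable1_diffP/differentiable_continuous. Qed.

Lemma is_derive_along (V : normedModType R) (f : V -> R) (g : R -> V) t :
  differentiable f (g t) -> derivable g t 1 ->
  is_derive t 1 (f \o g) ('D_('D_1 g t) f (g t)).
Proof.
move=> df /derivable1_diffP dg.
apply: DeriveDef; first exact/diff_derivable/differentiable_comp.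
rewrite deriveE; last exact: differentiable_comp.
by rewrite diff_comp//= -deriveE// -deriveE.
Qed.

Lemma is_derive1_pair (V W : normedModType R) (f : R -> V) (h : R -> W) t (df : V) (dh : W) :
  is_derive t 1 f df -> is_derive t 1 h dh ->
  is_derive t 1 (fun s => (f s, h s)) (df, dh).
Proof.
move=> [Df fE] [Dh hE]; apply: DeriveDef.
  by apply/derivable1_diffP/differentiable_pair; apply/derivable1_diffP.
have df1 : differentiable f t by exact/derivable1_diffP.
have dh1 : differentiable h t by exact/derivable1_diffP.
rewrite deriveE; last exact: differentiable_pair.
by rewrite diff_pair//= -!deriveE// fE hE.
Qed.

Lemma is_derive1_scalel (V : normedModType R) f (v : V) t (df : R) :
  is_derive t 1 f df -> is_derive t 1 (fun s => f s *: v) (df *: v).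
Proof.
move=> [Df fE]; have df1 : differentiable f t by exact/derivable1_diffP.
apply: DeriveDef; first exact/derivable1_diffP/differentiableZl.
rewrite deriveE; last exact: differentiableZl.
by rewrite diffZl//= -deriveE// fE.
Qed.

Lemma continuous_fD f h t : {for t, continuous f} ->
  {for t, continuous h} -> {for t, continuous (fun s => f s + h s)}.
Proof. by move=> fc hc; exact: cvgD. Qed.

Lemma continuous_fN f t : {for t, continuous f} ->
  {for t, continuous (fun s => - f s)}.
Proof. by move=> fc; exact: cvgN. Qed.

Lemma continuous_pair (V W : normedModType R) (f : R -> V) (h : R -> W) t :
  {for t, continuous f} -> {for t, continuous h} ->
  {for t, continuous (fun s => (f s, h s))}.
Proof. by move=> fc hc; exact: cvg_pair. Qed.

Lemma continuous_scalel (V : normedModType R) f (v : V) t :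
  {for t, continuous f} -> {for t, continuous (fun s => f s *: v)}.
Proof. by move=> fc; exact: cvgZr_tmp. Qed.

Lemma continuous_fM f h t : {for t, continuous f} ->
  {for t, continuous h} -> {for t, continuous (fun s => f s * h s)}.
Proof. by move=> fc hc; exact: cvgM. Qed.

Lemma continuous_fB f h t : {for t, continuous f} ->
  {for t, continuous h} -> {for t, continuous (fun s => f s - h s)}.
Proof. by move=> fc hc; exact: cvgB. Qed.

Lemma continuous_fV f t : f t != 0 -> {for t, continuous f} ->
  {for t, continuous (fun s => (f s)^-1)}.
Proof. by move=> f0 fc; exact: cvgV. Qed.

Lemma continuous_fc (c : R) (t : R) : {for t, continuous (fun=> c : R)}.
Proof. exact: cvg_cst. Qed.

Lemma continuous_sumr (n : nat) (h : 'I_n -> R -> R) t :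
  (forall i, {for t, continuous (h i)}) ->
  {for t, continuous (fun s => \sum_i h i s)}.
Proof.
move=> hc; have -> : (fun s => \sum_i h i s) = \sum_i h i.
  by apply/funext => s; rewrite fct_sumE.
apply: (big_ind (fun f : R -> R => {for t, continuous f})) => //.
  exact: cvg_cst.
by move=> f1 f2 c1 c2; exact: cvgD.
Qed.

End Curves.

(** * The Euclidean product *)

Section EuclideanProduct.
Context {R : realType}.

Lemma dotp_ge0 n (u : 'cV[R]_n) : 0 <= dotp u u.
Proof. by apply: sumr_ge0 => i _; rewrite -expr2 sqr_ge0. Qed.

Lemma dotp_ge n (u : 'cV[R]_n) i : u i 0 ^+ 2 <= dotp u u.
Proof.
rewrite /dotp (bigD1 i)//= -expr2 lerDl.
by apply: sumr_ge0 => j _; rewrite -expr2 sqr_ge0.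
Qed.

Lemma dotp_eq0 n (u : 'cV[R]_n) : dotp u u = 0 -> u = 0.
Proof.
move=> u0; apply/colP => i; rewrite [RHS]mxE.
have : u i 0 ^+ 2 <= 0 by rewrite -u0; exact: dotp_ge.
by rewrite le_eqVlt ltNge sqr_ge0 orbF sqrf_eq0 => /eqP.
Qed.

Lemma dotpE n (u v : 'cV[R]_n) : dotp u v = (u^T *m v) 0 0.
Proof. by rewrite /dotp mxE; apply: eq_bigr => i _; rewrite mxE. Qed.

Lemma dotpC n (u v : 'cV[R]_n) : dotp u v = dotp v u.
Proof. by apply: eq_bigr => i _; rewrite mulrC. Qed.

Lemma dotpDl n (u v w : 'cV[R]_n) : dotp (u + v) w = dotp u w + dotp v w.
Proof. by rewrite !dotpE linearD mulmxDl mxE. Qed.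

Lemma dotpZl n c (u v : 'cV[R]_n) : dotp (c *: u) v = c * dotp u v.
Proof. by rewrite !dotpE linearZ -scalemxAl mxE. Qed.

Lemma dotpNl n (u v : 'cV[R]_n) : dotp (- u) v = - dotp u v.
Proof. by rewrite -scaleN1r dotpZl mulN1r. Qed.

Lemma dotpDr n (u v w : 'cV[R]_n) : dotp w (u + v) = dotp w u + dotp w v.
Proof. by rewrite dotpC dotpDl !(dotpC _ w). Qed.

Lemma dotpZr n c (u v : 'cV[R]_n) : dotp v (c *: u) = c * dotp v u.
Proof. by rewrite dotpC dotpZl dotpC. Qed.

Lemma dotp0 n (u : 'cV[R]_n) : dotp u 0 = 0.
Proof. by rewrite /dotp big1// => i _; rewrite mxE mulr0. Qed.

Lemma dotp_mulmx n (A : 'M[R]_n) (u v : 'cV[R]_n) :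
  dotp (A *m u) v = dotp u (A^T *m v).
Proof. by rewrite !dotpE trmx_mul mulmxA. Qed.

Lemma dotp_delta n (u : 'cV[R]_n) l : dotp u (delta_mx l 0) = u l 0.
Proof.
rewrite /dotp (bigD1 l)//= [delta_mx _ _ _ _]mxE !eqxx mulr1 big1 ?addr0// => i il.
by rewrite [delta_mx _ _ _ _]mxE (negbTE il) mulr0.
Qed.

(** With A = sum u^2, B = sum u w and C = sum w^2, expanding the nonnegative sum
    of the (A w_i - B u_i)^2 gives A (A C - B^2). *)
Lemma cauchy_schwarz n (u w : 'I_n -> R) :
  (\sum_i u i * w i) ^+ 2 <= (\sum_i u i ^+ 2) * (\sum_i w i ^+ 2).
Proof.
have E a b : \sum_i (a * w i - b * u i) ^+ 2 = a ^+ 2 * (\sum_i w i ^+ 2)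
    + (- (2 * a * b) * (\sum_i u i * w i) + b ^+ 2 * (\sum_i u i ^+ 2)).
  by rewrite !mulr_sumr -!big_split /=; apply: eq_bigr => i _; ring.
set A := \sum_i u i ^+ 2; set B := \sum_i u i * w i; set C := \sum_i w i ^+ 2.
have A0 : 0 <= A by apply: sumr_ge0 => i _; exact: sqr_ge0.
have H : 0 <= A * (A * C - B ^+ 2).
  have : 0 <= \sum_i (A * w i - B * u i) ^+ 2 by apply: sumr_ge0 => i _; exact: sqr_ge0.
  by rewrite E -/A -/B -/C; congr (0 <= _); ring.
have [A_eq0|A_neq0] := eqVneq A 0; last first.
  by rewrite -subr_ge0 -(pmulr_rge0 _ (_ : 0 < A)) // lt_neqAle eq_sym A_neq0.
suff -> : B = 0 by rewrite expr0n mulr_ge0// sumr_ge0// => i _; exact: sqr_ge0.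
rewrite /B big1// => i _; suff -> : u i = 0 by rewrite mul0r.
apply/eqP; rewrite -sqrf_eq0; apply/eqP; apply: le_anti; rewrite sqr_ge0 andbT.
by rewrite -A_eq0 /A (bigD1 i)//= lerDl sumr_ge0// => j _; exact: sqr_ge0.
Qed.

End EuclideanProduct.

(** * Coordinates and frame *)

Section Coordinates.
Context {R : realType} {mu nu : nat}.
Local Notation DR := (ambient R mu nu).
Implicit Types (p v : DR) (f g : DR -> R).

Lemma near_DRset p : DRset p -> \forall q \near p, DRset q.
Proof.
move=> p0; have : {for p, continuous (snd : DR -> R)} by apply: cvg_snd.
by move=> /cvgr_gt; apply.
Qed.

Definition coordx i (p : DR) : R := p.1.1 i 0.
Definition coordz k (p : DR) : R := p.1.2 k 0.

Lemma differentiable_a p : differentiable (snd : DR -> R) p.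
Proof.
apply: linear_differentiable => ?; exact: cvg_snd.
Qed.
Lemma differentiable_coordx i p : differentiable (coordx i) p.
Proof.
apply: (@differentiable_comp _ _ _ _ (fst \o fst) (fun M : 'cV[R]_mu => M i 0)).
  apply: differentiable_comp.
   apply: linear_differentiable => ?; exact: cvg_fst.
   apply: linear_differentiable => ?; exact: cvg_fst.
exact: differentiable_coord.
Qed.
Lemma differentiable_coordz i p : differentiable (coordz i) p.
Proof.
apply: (@differentiable_comp _ _ _ _ (snd \o fst) (fun M : 'cV[R]_nu => M i 0)).
  apply: differentiable_comp.
   apply: linear_differentiable => ?; exact: cvg_fst.
   apply: linear_differentiable => ?; exact: cvg_snd.
exact: differentiable_coord.
Qed.

(** The difference quotient of a function that is affine along v is constant. *)
Lemma is_derive_affine f p v l : differentiable f p ->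
  (forall h, f (h *: v + p) = h * l + f p) -> is_derive p v f l.
Proof.
move=> df fE; apply: DeriveDef; first exact: diff_derivable.
rewrite /derive; apply: lim_near_cst => //; near=> h.
have h0 : h != 0 by near: h; exact: nbhs_dnbhs_neq.
by rewrite /= fE addrK /GRing.scale/= mulKf.
Unshelve. all: by end_near. Qed.

Lemma is_derive_a p v : is_derive p v (snd : DR -> R) v.2.
Proof. by apply: is_derive_affine => //; exact: differentiable_a. Qed.
Lemma is_derive_x i p v : is_derive p v (coordx i) (coordx i v).
Proof.
apply: is_derive_affine => [|h]; first exact: differentiable_coordx.
by rewrite /coordx /= !mxE.
Qed.
Lemma is_derive_z i p v : is_derive p v (coordz i) (coordz i v).
Proof.
apply: is_derive_affine => [|h]; first exact: differentiable_coordz.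
by rewrite /coordz /= !mxE.
Qed.

End Coordinates.

Section Classes.
Context {R : realType} {mu nu : nat} (J : 'cV[R]_nu -> 'M[R]_mu).
Local Notation DR := (ambient R mu nu).
Local Notation idx := ('I_(1 + (mu + nu))).
Local Notation DX i f := (frame_derive J i f).
Implicit Types (p v : DR) (f g : DR -> R).

Definition idx_a : idx := lshift (mu + nu) 0.
Definition idx_x l : idx := rshift 1 (lshift nu l).
Definition idx_z k : idx := rshift 1 (rshift mu k).

Lemma idx_case (P : idx -> Prop) :
  P idx_a -> (forall l, P (idx_x l)) -> (forall k, P (idx_z k)) ->
  forall i, P i.
Proof.
move=> Pa Px Pz i; case: (split_ordP i) => [j ->|j ->]; first by rewrite (ord1 j).
by case: (split_ordP j) => [l ->|k ->]; [exact: Px|exact: Pz].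
Qed.

Lemma big_idx (F : idx -> R) :
  \sum_i F i = F idx_a + (\sum_l F (idx_x l) + \sum_k F (idx_z k)).
Proof. by rewrite big_split_ord big_ord1 big_split_ord. Qed.

Lemma bracket_delta (x : 'cV[R]_mu) l k :
  bracket J x (delta_mx l 0) k 0 = (J (delta_mx k 0) *m x) l 0.
Proof. by rewrite mxE dotp_delta. Qed.

Lemma frame_aE p : frame J idx_a p = (0, 0, p.2).
Proof. by rewrite /frame (unsplitK (inl _)). Qed.

Lemma frame_xE l p : frame J (idx_x l) p =
  (Num.sqrt p.2 *: delta_mx l 0,
   (2^-1 * Num.sqrt p.2) *: bracket J p.1.1 (delta_mx l 0), 0).
Proof. by rewrite /frame (unsplitK (inr _)) (unsplitK (inl _)). Qed.

Lemma frame_zE k p : frame J (idx_z k) p = (0, p.2 *: delta_mx k 0, 0).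
Proof. by rewrite /frame !(unsplitK (inr _)). Qed.

Definition root_a p : R := Num.sqrt p.2.

Lemma root_a_gt0 p : DRset p -> 0 < root_a p. Proof. by move=> ?; rewrite sqrtr_gt0. Qed.

Lemma root_a_neq0 p : DRset p -> root_a p != 0. Proof. by move/root_a_gt0/lt0r_neq0. Qed.

Lemma root_aK p : DRset p -> root_a p * root_a p = p.2.
Proof. by move=> ?; rewrite -expr2 sqr_sqrtr// ltW. Qed.

Lemma differentiable_root_a p : DRset p -> differentiable root_a p.
Proof. by move=> p0; apply: differentiable_sqrt_comp => //; exact: differentiable_a. Qed.

Lemma is_derive_root_a p v : DRset p -> is_derive p v root_a (v.2 / (2 * root_a p)).
Proof.
move=> p0; rewrite mulrC.
apply: (is_derive_comp1 (h := Num.sqrt) (f := snd)).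
- exact: differentiable_a.
- exact: is_derive1_sqrt.
- exact: is_derive_a.
Qed.

Lemma frame_derive_near i f g p : (\near p, f p = g p) -> DX i f p = DX i g p.
Proof. exact: near_eq_derive. Qed.

Lemma frame_deriveE i f p (df : R) :
  is_derive p (frame J i p) f df -> DX i f p = df.
Proof. by move=> D; exact: derive_val. Qed.

(** S is open, so the values of f outside S do not affect X_i f on S. *)
Lemma frame_derive_ext i f g : (forall p, DRset p -> f p = g p) ->
  forall p, DRset p -> DX i f p = DX i g p.
Proof.
move=> fg p p0; apply: frame_derive_near.
by apply: filterS (near_DRset p0) => q; exact: fg.
Qed.

(** * Functions of order one half and one *)

(** Linear span, with functions identified when they agree on S: the
    derivatives below are only computed there. *)
Inductive lspan (P : (DR -> R) -> Prop) : (DR -> R) -> Prop :=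
| lspan_gen f : P f -> lspan P f
| lspan_add f g : lspan P f -> lspan P g -> lspan P (fun p => f p + g p)
| lspan_scale c f : lspan P f -> lspan P (fun p => c * f p)
| lspan_ext f g : (forall p, DRset p -> f p = g p) -> lspan P f -> lspan P g.

Lemma lspan_sum (P : (DR -> R) -> Prop) f0 (I : Type) (r : seq I) (F : I -> DR -> R) :
  P f0 -> (forall i, lspan P (F i)) -> lspan P (fun p => \sum_(i <- r) F i p).
Proof.
move=> Pf0 PF; elim: r => [|i r IH].
  apply: (lspan_ext (f := fun p => 0 * f0 p)) => [p _|].
    by rewrite big_nil mul0r.
  exact/lspan_scale/lspan_gen.
apply: lspan_ext (lspan_add (PF i) IH) => p _.
by rewrite big_cons.
Qed.

Lemma lspan_differentiable P :
  (forall f, P f -> forall p, DRset p -> differentiable f p) ->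
  forall f, lspan P f -> forall p, DRset p -> differentiable f p.
Proof.
move=> PD f; elim=> {f} [f|f g _ IHf _ IHg|c f _ IHf|f g fg _ IHf] p.
- exact: PD.
- by move=> p0; apply: differentiableD; [exact: IHf|exact: IHg].
- by move=> p0; apply: differentiableZ; exact: IHf.
- move=> p0; apply: near_differentiable (IHf _ p0).
  by apply: filterS (near_DRset p0) => q; exact: fg.
Qed.

Lemma lspan_frame_derive P Q i :
  (forall f, P f -> forall p, DRset p -> differentiable f p) ->
  (forall f, P f -> lspan Q (DX i f)) ->
  forall f, lspan P f -> lspan Q (DX i f).
Proof.
move=> PD PQ f; elim=> {f} [f|f g sf IHf sg IHg|c f sf IHf|f g fg sf IHf].
- exact: PQ.
- apply: lspan_ext (lspan_add IHf IHg) => p p0; rewrite /frame_derive.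
  have /diff_derivable df := lspan_differentiable PD sf p0.
  have /diff_derivable dg := lspan_differentiable PD sg p0.
  by rewrite -deriveD.
- apply: lspan_ext (lspan_scale c IHf) => p p0; rewrite /frame_derive.
  have /diff_derivable df := lspan_differentiable PD sf p0.
  by rewrite [RHS](@deriveZ _ _ _ f).
- exact: lspan_ext (frame_derive_ext i fg) IHf.
Qed.

Lemma lspan_bound P (w : DR -> R) :
  (forall p, DRset p -> 0 <= w p) ->
  (forall f, P f -> exists C, forall p, DRset p -> `|f p| <= C * w p) ->
  forall f, lspan P f -> exists C, forall p, DRset p -> `|f p| <= C * w p.
Proof.
move=> w0 PB f; elim=> {f} [f|f g _ [C fC] _ [D gD]|c f _ [C fC]|f g fg _ [C fC]].
- exact: PB.
- exists (C + D) => p p0; rewrite mulrDl (le_trans (ler_normD _ _))//.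
  by rewrite lerD ?fC ?gD.
- exists (`|c| * C) => p p0.
  by rewrite normrM -mulrA ler_wpM2l ?fC.
- by exists C => p p0; rewrite -fg ?fC.
Qed.

(** The generators are the functions whose squares are dominated by cosh r and
    whose span is invariant under right translations of the group. *)
Inductive order_half_gen : (DR -> R) -> Prop :=
| order_half_root_a : order_half_gen root_a
| order_half_root_aV : order_half_gen (fun p => (root_a p)^-1)
| order_half_x i : order_half_gen (coordx i)
| order_half_xx i j : order_half_gen (fun p => coordx i p * coordx j p * (root_a p)^-1)
| order_half_z k : order_half_gen (fun p => coordz k p * (root_a p)^-1).

Definition order_half := lspan order_half_gen.

Lemma differentiable_root_aV p : DRset p -> differentiable (fun p => (root_a p)^-1) p.
Proof. by move=> p0; apply: differentiableV (root_a_neq0 p0); exact: differentiable_root_a. Qed.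

Lemma order_half_gen_differentiable f : order_half_gen f ->
  forall p, DRset p -> differentiable f p.
Proof.
case=> [||i|i j|k] p p0.
- exact: differentiable_root_a.
- exact: differentiable_root_aV.
- exact: differentiable_coordx.
- apply: (@differentiableM _ _ (fun p => coordx i p * coordx j p)).
    apply: (@differentiableM _ _ (coordx i) (coordx j)).
      exact: differentiable_coordx.
    exact: differentiable_coordx.
  exact: differentiable_root_aV.
- apply: (@differentiableM _ _ (coordz k)).
    exact: differentiable_coordz.
  exact: differentiable_root_aV.
Qed.

Lemma is_derive_root_aV p v : DRset p ->
  is_derive p v (fun p => (root_a p)^-1) (- (v.2 / (2 * root_a p)) / p.2).
Proof.
move=> p0; have dr := is_derive_root_a v p0; have r0 := root_a_neq0 p0.
apply: DeriveDef; first exact: derivableV.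
rewrite deriveV// derive_val /GRing.scale/= -(root_aK p0).
by field.
Qed.

Lemma is_derive_xx i j p v : DRset p ->
  is_derive p v (fun p => coordx i p * coordx j p * (root_a p)^-1)
    ((coordx i p * coordx j v + coordx j p * coordx i v) / root_a p
     - coordx i p * coordx j p * v.2 / (2 * root_a p * p.2)).
Proof.
move=> p0.
apply: (is_derive_eq (is_derive_fM (is_derive_fM (is_derive_x i p v) (is_derive_x j p v)) (is_derive_root_aV v p0))).
by rewrite -(root_aK p0); have := root_a_neq0 p0 => r0; field.
Qed.

Lemma is_derive_za k p v : DRset p ->
  is_derive p v (fun p => coordz k p * (root_a p)^-1)
    (coordz k v / root_a p - coordz k p * v.2 / (2 * root_a p * p.2)).
Proof.
move=> p0.
apply: (is_derive_eq (is_derive_fM (is_derive_z k p v) (is_derive_root_aV v p0))).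
by rewrite -(root_aK p0); have := root_a_neq0 p0 => r0; field.
Qed.

Lemma lspan0 (P : (DR -> R) -> Prop) f f0 : P f0 ->
  (forall p, DRset p -> f p = 0) -> lspan P f.
Proof.
move=> P0 f0E; apply: (lspan_ext (f := fun p => 0 * f0 p)) => [p p0|].
  by rewrite f0E// mul0r.
exact/lspan_scale/lspan_gen.
Qed.

End Classes.

Section Quadratic.
Context {R : realType} {mu nu : nat} (J : 'cV[R]_nu -> 'M[R]_mu).
Local Notation DR := (ambient R mu nu).
Local Notation DX i f := (frame_derive J i f).
Implicit Types (p v : DR) (f g : DR -> R).

(** The field X_0 multiplies each generator by a constant, since it measures the
    homogeneity in a.  The fields in the direction of x send x_i x_j a^(-1/2) to
    combinations of the x_i, the x_i to multiples of a^(1/2), and z_k a^(-1/2)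
    to combinations of the x_i; those in the direction of z send z_k a^(-1/2)
    to multiples of a^(1/2).  All the other derivatives vanish. *)
Lemma order_half_gen_frame_derive i f : order_half_gen f -> order_half (DX i f).
Proof.
have L0 g : (forall p, DRset p -> g p = 0) -> order_half g.
  by move=> g0; apply: lspan0 g0; exact: order_half_root_a.
have Lc c g h : order_half_gen h -> (forall p, DRset p -> g p = c * h p) -> order_half g.
  move=> hg E; apply: lspan_ext (lspan_scale c (lspan_gen hg)) => p p0.
  by rewrite E.
move=> gf; have gf0 := gf; case: gf => [||m|m n|k] in gf0 *; elim/(@idx_case mu nu): i => [|l|l].
- apply: (Lc 2^-1 _ _ gf0) => p p0.
  rewrite (frame_deriveE (is_derive_root_a _ p0)) frame_aE /=.
  by rewrite -(root_aK p0); have := root_a_neq0 p0 => r0; field.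
- apply: L0 => p p0.
  rewrite (frame_deriveE (is_derive_root_a _ p0)) frame_xE /=.
  by rewrite mul0r.
- apply: L0 => p p0.
  rewrite (frame_deriveE (is_derive_root_a _ p0)) frame_zE /=.
  by rewrite mul0r.
- apply: (Lc (- 2^-1) _ _ gf0) => p p0.
  rewrite (frame_deriveE (is_derive_root_aV _ p0)) frame_aE /=.
  by rewrite -(root_aK p0); have := root_a_neq0 p0 => r0; field.
- apply: L0 => p p0.
  rewrite (frame_deriveE (is_derive_root_aV _ p0)) frame_xE /=.
  by rewrite mul0r oppr0 mul0r.
- apply: L0 => p p0.
  rewrite (frame_deriveE (is_derive_root_aV _ p0)) frame_zE /=.
  by rewrite mul0r oppr0 mul0r.
- apply: L0 => p p0.
  rewrite (frame_deriveE (is_derive_x _ _ _)) frame_aE /=.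
  by rewrite /coordx mxE.
- apply: (Lc (m == l)%:R _ _ (@order_half_root_a R mu nu)) => p p0.
  rewrite (frame_deriveE (is_derive_x _ _ _)) frame_xE /=.
  by rewrite /coordx /= !mxE andbT mulrC.
- apply: L0 => p p0.
  rewrite (frame_deriveE (is_derive_x _ _ _)) frame_zE /=.
  by rewrite /coordx mxE.
- apply: (Lc (- 2^-1) _ _ gf0) => p p0.
  rewrite (frame_deriveE (is_derive_xx _ _ _ p0)) frame_aE /=.
  rewrite {2 4}/coordx /= !mxE -(root_aK p0).
  by have := root_a_neq0 p0 => r0; field.
- apply: (lspan_ext (f := fun p => (m == l)%:R * coordx n p + (n == l)%:R * coordx m p)).
    move=> p p0.
    rewrite (frame_deriveE (is_derive_xx _ _ _ p0)) frame_xE /=.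
    rewrite {4 6}/coordx /= !mxE !andbT -[Num.sqrt _]/(root_a p).
    by rewrite -(root_aK p0); have := root_a_neq0 p0 => r0; field.
  by apply: lspan_add; apply/lspan_scale/lspan_gen/order_half_x.
- apply: L0 => p p0.
  rewrite (frame_deriveE (is_derive_xx _ _ _ p0)) frame_zE /=.
  by rewrite /coordx /= !mxE !mulr0 addr0 !mul0r subr0.
- apply: (Lc (- 2^-1) _ _ gf0) => p p0.
  rewrite (frame_deriveE (is_derive_za _ _ p0)) frame_aE /=.
  rewrite {1}/coordz /= !mxE -(root_aK p0).
  by have := root_a_neq0 p0 => r0; field.
- apply: (lspan_ext (f := fun p => 2^-1 * \sum_i J (delta_mx k 0) l i * coordx i p)).
    move=> p p0.
    rewrite (frame_deriveE (is_derive_za _ _ p0)) frame_xE /=.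
    rewrite {1}/coordz /= mxE bracket_delta mxE -[Num.sqrt _]/(root_a p).
    by rewrite -(root_aK p0); have := root_a_neq0 p0 => r0; field.
  apply: lspan_scale; apply: lspan_sum; first exact: order_half_root_a.
  by move=> i; apply: lspan_scale; apply/lspan_gen/order_half_x.
- apply: (Lc (k == l)%:R _ _ (@order_half_root_a R mu nu)) => p p0.
  rewrite (frame_deriveE (is_derive_za _ _ p0)) frame_zE /=.
  rewrite {1}/coordz /= !mxE andbT.
  by rewrite -(root_aK p0); have := root_a_neq0 p0 => r0; field.
Qed.

Lemma order_half_differentiable f : order_half f -> forall p, DRset p -> differentiable f p.
Proof. exact: lspan_differentiable order_half_gen_differentiable f. Qed.

Lemma order_half_frame_derive i f : order_half f -> order_half (DX i f).
Proof.
exact: lspan_frame_derive order_half_gen_differentiable (@order_half_gen_frame_derive i) f.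
Qed.

Inductive order_one_gen : (DR -> R) -> Prop :=
| order_one_mul f g : order_half f -> order_half g -> order_one_gen (fun p => f p * g p).

Definition order_one := lspan order_one_gen.

Lemma order_one_gen_differentiable f : order_one_gen f ->
  forall p, DRset p -> differentiable f p.
Proof.
case=> {}f g lf lg p p0.
by apply: (@differentiableM _ _ f g); exact: order_half_differentiable.
Qed.

Lemma order_one_differentiable f : order_one f -> forall p, DRset p -> differentiable f p.
Proof. exact: lspan_differentiable order_one_gen_differentiable f. Qed.

Lemma order_one_frame_derive i f : order_one f -> order_one (DX i f).
Proof.
apply: lspan_frame_derive order_one_gen_differentiable _ f => f [{}f g lf lg].
have H1 : order_one (fun p => f p * DX i g p).
  by apply/lspan_gen/order_one_mul => //; exact: order_half_frame_derive.
have H2 : order_one (fun p => DX i f p * g p).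
  by apply/lspan_gen/order_one_mul => //; exact: order_half_frame_derive.
apply: lspan_ext (lspan_add H1 H2) => p p0; rewrite /frame_derive.
have /diff_derivable df := order_half_differentiable lf p0.
have /diff_derivable dg := order_half_differentiable lg p0.
rewrite [RHS](@deriveM _ _ f g)//= /GRing.scale/=; congr (_ + _).
by rewrite mulrC.
Qed.

(** The value of cosh (r / 2) at (x, 0, a). *)
Definition cosh_half p : R :=
  (root_a p + (root_a p)^-1) / 2 + dotp p.1.1 p.1.1 / (8 * root_a p).

Definition cosh_dist p : R :=
  2 * cosh_half p ^+ 2 - 1 + dotp p.1.2 p.1.2 / (2 * p.2).

Lemma order_half_cosh_half : order_half cosh_half.
Proof.
pose f p := 2^-1 * root_a p + (2^-1 * (root_a p)^-1
  + 8^-1 * \sum_i coordx i p * coordx i p * (root_a p)^-1).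
apply: (lspan_ext (f := f)) => [p p0|].
  rewrite /f /cosh_half -big_distrl/= -[\sum_i _]/(dotp p.1.1 p.1.1).
  by have := root_a_neq0 p0 => r0; field.
apply: lspan_add; first by apply/lspan_scale/lspan_gen/order_half_root_a.
apply: lspan_add; first by apply/lspan_scale/lspan_gen/order_half_root_aV.
apply/lspan_scale/lspan_sum; first exact: order_half_root_a.
by move=> i; apply/lspan_gen/order_half_xx.
Qed.

Lemma order_one_cosh_dist : order_one cosh_dist.
Proof.
pose f p := 2 * (cosh_half p * cosh_half p) + (-1 * (root_a p * (root_a p)^-1)
  + 2^-1 * \sum_i (coordz i p * (root_a p)^-1) * (coordz i p * (root_a p)^-1)).
apply: (lspan_ext (f := f)) => [p p0|].
  rewrite /f /cosh_dist -addrA -(root_aK p0) expr2; have r0 := root_a_neq0 p0.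
  congr (_ + (_ + _)); first by field.
  under eq_bigr do rewrite mulrACA.
  rewrite -big_distrl/= -[\sum_i _]/(dotp p.1.2 p.1.2).
  by field.
apply: lspan_add.
  by apply/lspan_scale/lspan_gen/order_one_mul; exact: order_half_cosh_half.
apply: lspan_add.
  by apply/lspan_scale/lspan_gen/order_one_mul; apply: lspan_gen; [exact: order_half_root_a|exact: order_half_root_aV].
have lz k : order_half (fun p => coordz k p * (root_a p)^-1) by apply/lspan_gen/order_half_z.
apply/lspan_scale/lspan_sum; last by move=> i; apply/lspan_gen/order_one_mul.
apply: (@order_one_mul root_a root_a); exact/lspan_gen/order_half_root_a.
Qed.

(** In expanded form cosh r is a sum of nonnegative monomials, so it dominates
    each of them. *)
Lemma cosh_distE p : DRset p ->
  cosh_dist p = (p.2 + p.2^-1) / 2 + dotp p.1.1 p.1.1 * (1 + p.2^-1) / 4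
    + dotp p.1.1 p.1.1 ^+ 2 / (32 * p.2) + dotp p.1.2 p.1.2 / (2 * p.2).
Proof.
move=> p0; rewrite /cosh_dist /cosh_half -(root_aK p0).
by have r0 := root_a_neq0 p0; field.
Qed.

(** The squares a, 1/a, x_i^2, x_i^2 x_j^2 / a and z_k^2 / a of the generators
    are bounded by monomials of cosh r, whose smallest coefficient is 1/32. *)
Lemma order_half_gen_bound f : order_half_gen f ->
  exists C, forall p, DRset p -> `|f p| <= C * Num.sqrt (cosh_dist p).
Proof.
have K g : (forall p, DRset p -> g p ^+ 2 <= 32 * cosh_dist p) ->
    exists C, forall p, DRset p -> `|g p| <= C * Num.sqrt (cosh_dist p).
  move=> gC; exists (Num.sqrt 32) => p p0.
  by rewrite -sqrtrM// -sqrtr_sqr ler_wsqrtr// gC.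
have P p : DRset p -> [/\ 0 < p.2^-1, 0 <= dotp p.1.1 p.1.1,
    0 <= dotp p.1.1 p.1.1 / p.2, 0 <= dotp p.1.1 p.1.1 ^+ 2 / p.2
    & 0 <= dotp p.1.2 p.1.2 / p.2].
  move=> p0; have pi0 : 0 < p.2^-1 by rewrite invr_gt0.
  split=> //; rewrite ?dotp_ge0// ?mulr_ge0 ?sqr_ge0 ?dotp_ge0//; exact: ltW.
have E p : DRset p -> 32 * cosh_dist p = 16 * p.2 + 16 * p.2^-1
    + 8 * dotp p.1.1 p.1.1 + 8 * (dotp p.1.1 p.1.1 / p.2)
    + dotp p.1.1 p.1.1 ^+ 2 / p.2 + 16 * (dotp p.1.2 p.1.2 / p.2).
  by move=> p0; rewrite cosh_distE//; have r0 : p.2 != 0 by [exact: lt0r_neq0]; field.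
case=> [||m|m n|k]; apply: K => p p0; have a0 : 0 < p.2 := p0;
  have [b0 c0 d0 e0 f0] := P p p0; have a1 := lt0r_neq0 a0; rewrite E//.
- rewrite expr2 root_aK//; lra.
- rewrite exprVn expr2 root_aK//; lra.
- have := dotp_ge p.1.1 m; rewrite -/(coordx m p); lra.
- rewrite !exprMn exprVn [root_a p ^+ 2]expr2 root_aK//.
  have := dotp_ge p.1.1 m; have := dotp_ge p.1.1 n.
  rewrite -/(coordx m p) -/(coordx n p) => n1 m1.
  have : coordx m p ^+ 2 * coordx n p ^+ 2 / p.2 <= dotp p.1.1 p.1.1 ^+ 2 / p.2.
    by rewrite ler_pM2r// expr2 ler_pM// sqr_ge0.
  lra.
- rewrite exprMn exprVn [root_a p ^+ 2]expr2 root_aK//.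
  have := dotp_ge p.1.2 k; rewrite -/(coordz k p) => k1.
  have : coordz k p ^+ 2 / p.2 <= dotp p.1.2 p.1.2 / p.2 by rewrite ler_pM2r.
  lra.
Qed.

Lemma order_half_bound f : order_half f ->
  exists C, forall p, DRset p -> `|f p| <= C * Num.sqrt (cosh_dist p).
Proof.
by move=> lf; apply: lspan_bound order_half_gen_bound _ lf => p _; exact: sqrtr_ge0.
Qed.

(** Here a + |x|^2 / 4 is the height of the point in the Siegel domain model. *)
Lemma cosh_distB1 p : DRset p -> cosh_dist p - 1 =
  ((p.2 + dotp p.1.1 p.1.1 / 4 - 1) ^+ 2 + dotp p.1.1 p.1.1 + dotp p.1.2 p.1.2)
    / (2 * p.2).
Proof.
move=> p0; rewrite cosh_distE//.
by have r0 : p.2 != 0 by [exact: lt0r_neq0]; field.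
Qed.

Lemma cosh_dist_ge1 p : DRset p -> 1 <= cosh_dist p.
Proof.
move=> p0; rewrite -subr_ge0 cosh_distB1// divr_ge0//.
  by rewrite !addr_ge0 ?dotp_ge0 ?sqr_ge0.
by rewrite mulr_ge0// ltW.
Qed.

Lemma cosh_dist_gt1 p : DRset p -> p <> DRone mu nu -> 1 < cosh_dist p.
Proof.
move=> p0 pe; rewrite lt_neqAle cosh_dist_ge1// andbT; apply/eqP => F1.
apply: pe; have := cosh_distB1 p0; rewrite -F1 subrr => /esym/eqP.
have d0 : 2 * p.2 != 0 by rewrite mulf_neq0// lt0r_neq0.
rewrite mulf_eq0 invr_eq0 (negbTE d0) orbF.
rewrite !paddr_eq0 ?addr_ge0 ?dotp_ge0 ?sqr_ge0//.
move=> /andP[/andP[/eqP h /eqP/dotp_eq0 x0] /eqP/dotp_eq0 z0].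
case: p x0 z0 h {p0 F1 d0} => [[x z] a] /= -> -> /eqP.
rewrite sqrf_eq0 subr_eq0 /dotp big1 ?mul0r ?addr0 => [/eqP ->//|i _].
by rewrite mxE mul0r.
Qed.

Lemma order_one_bound f : order_one f ->
  exists C, forall p, DRset p -> `|f p| <= C * cosh_dist p.
Proof.
have F0 p : DRset p -> 0 <= cosh_dist p.
  by move=> p0; apply: le_trans (cosh_dist_ge1 p0); exact: ler01.
move=> qf; apply: (lspan_bound F0) qf => _ [{}f g lf lg].
have [C fC] := order_half_bound lf; have [D gD] := order_half_bound lg.
exists (C * D) => p p0; rewrite normrM -[cosh_dist p](sqr_sqrtr (F0 _ p0)).
by rewrite expr2 mulrACA ler_pM ?fC ?gD.
Qed.

End Quadratic.

(** * The gradient of cosh r *)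

Section Gradient.
Context {R : realType} {mu nu : nat} (J : {linear 'cV[R]_nu -> 'M[R]_mu}).
Hypothesis J_skew : forall z, (J z)^T = - J z.
Hypothesis J_orth : forall z, enorm z = 1 -> (J z)^T *m J z = 1%:M.
Local Notation DR := (ambient R mu nu).
Local Notation DX i f := (frame_derive J i f).
Implicit Types (p v : DR) (f g : DR -> R).

(** Homogeneous form of the orthogonality of J_z for unit z. *)
Lemma J_sqr z : (J z)^T *m J z = (dotp z z)%:M.
Proof.
have [z0|z0] := eqVneq (dotp z z) 0.
  by rewrite (dotp_eq0 z0) linear0 mulmx0 /dotp big1 ?raddf0// => i _; rewrite mxE mul0r.
have zp : 0 < dotp z z by rewrite lt_neqAle eq_sym z0 dotp_ge0.
have n0 : enorm z != 0 by rewrite lt0r_neq0// sqrtr_gt0.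
have n2 : enorm z * enorm z = dotp z z by rewrite -expr2 sqr_sqrtr// ltW.
have /J_orth : enorm ((enorm z)^-1 *: z) = 1.
  rewrite {1}/enorm dotpZl dotpZr -n2 mulKf// mulVf// sqrtr1 //.
have -> : J ((enorm z)^-1 *: z) = (enorm z)^-1 *: J z by rewrite linearZ.
rewrite [(_ *: _)^T]linearZ /= -scalemxAl -scalemxAr scalerA.
move/(congr1 (fun M => dotp z z *: M)); rewrite scalerA -n2.
have -> : enorm z * enorm z * ((enorm z)^-1 * (enorm z)^-1) = 1 by field.
by rewrite scale1r scalemx1.
Qed.

(** Polarisation of [J_sqr] in z. *)
Lemma J_dot z w x : dotp (J z *m x) (J w *m x) = dotp z w * dotp x x.
Proof.
have S z' : dotp (J z' *m x) (J z' *m x) = dotp z' z' * dotp x x.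
  by rewrite dotp_mulmx mulmxA J_sqr mul_scalar_mx dotpZr.
have := S (z + w); rewrite linearD mulmxDl !(dotpDl, dotpDr) !S.
rewrite (dotpC w z) (dotpC (J w *m x)) !mulrDl => H.
have {}H : 2 * dotp (J z *m x) (J w *m x) = 2 * (dotp z w * dotp x x) by lra.
lra.
Qed.

Lemma J_dot0 z x : dotp (J z *m x) x = 0.
Proof.
have : dotp (J z *m x) x = - dotp (J z *m x) x.
  rewrite {1}dotp_mulmx J_skew mulNmx dotpC -scaleN1r dotpZl mulN1r //.
lra.
Qed.

Lemma J_delta_sum z : J z = \sum_k z k 0 *: J (delta_mx k 0).
Proof.
rewrite {1}(matrix_sum_delta z) linear_sum; apply: eq_bigr => k _.
by rewrite big_ord1 linearZ.
Qed.

Lemma dotp_bracket z x y : dotp z (bracket J x y) = dotp (J z *m x) y.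
Proof.
rewrite J_delta_sum mulmx_suml [RHS]dotpE linear_sum mulmx_suml summxE.
apply: eq_bigr => k _.
by rewrite mxE -scalemxAl -dotpE dotpZl.
Qed.

Lemma is_derive_dotpx p v :
  is_derive p v (fun q : DR => dotp q.1.1 q.1.1) (2 * dotp p.1.1 v.1.1).
Proof.
have -> : (fun q : DR => dotp q.1.1 q.1.1) = \sum_i (fun q => coordx i q * coordx i q).
  by apply/funext => q; rewrite fct_sumE.
apply: is_derive_eq.
  apply: is_derive_sum => i.
  exact: (is_derive_fM (is_derive_x i p v) (is_derive_x i p v)).
by rewrite /dotp mulr_sumr; apply: eq_bigr => i _; rewrite /coordx; ring.
Qed.

Lemma is_derive_dotpz p v :
  is_derive p v (fun q : DR => dotp q.1.2 q.1.2) (2 * dotp p.1.2 v.1.2).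
Proof.
have -> : (fun q : DR => dotp q.1.2 q.1.2) = \sum_i (fun q => coordz i q * coordz i q).
  by apply/funext => q; rewrite fct_sumE.
apply: is_derive_eq.
  apply: is_derive_sum => i.
  exact: (is_derive_fM (is_derive_z i p v) (is_derive_z i p v)).
by rewrite /dotp mulr_sumr; apply: eq_bigr => i _; rewrite /coordz; ring.
Qed.

Lemma is_derive_cosh_dist p v : DRset p ->
  is_derive p v (cosh_dist (mu := mu) (nu := nu))
    (let B := dotp p.1.1 p.1.1 in let Z := dotp p.1.2 p.1.2 in let a := p.2 in
     v.2 * ((1 - a ^- 2) / 2 - B / (4 * a ^+ 2) - B ^+ 2 / (32 * a ^+ 2)
            - Z / (2 * a ^+ 2))
     + dotp p.1.1 v.1.1 * ((1 + a^-1) / 2 + B / (8 * a))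
     + dotp p.1.2 v.1.2 / a).
Proof.
move=> p0; have a0 : p.2 != 0 by exact: lt0r_neq0.
have da := is_derive_a p v.
have dai : is_derive p v (fun q : DR => q.2^-1) (- v.2 / p.2 ^+ 2).
  apply: DeriveDef; first exact: (derivableV (f := snd : DR -> R)).
  rewrite (deriveV (f := snd : DR -> R))// derive_val /GRing.scale/=.
  by field.
have dB := is_derive_dotpx p v; have dZ := is_derive_dotpz p v.
have dc (c : R) : is_derive p v (fun=> c) 0 by exact: is_derive_cst.
pose f (q : DR) := 2^-1 * (q.2 + q.2^-1)
  + (4^-1 * (dotp q.1.1 q.1.1 * (1 + q.2^-1))
  + (32^-1 * (dotp q.1.1 q.1.1 * dotp q.1.1 q.1.1 * q.2^-1)
  + 2^-1 * (dotp q.1.2 q.1.2 * q.2^-1))).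
apply: (near_eq_is_derive (f := f)).
  apply: filterS (near_DRset p0) => q q0; rewrite cosh_distE// /f.
  have r0 : q.2 != 0 by [exact: lt0r_neq0].
  by field.
apply: (is_derive_eq (is_derive_fD
  (is_derive_fM (dc 2^-1) (is_derive_fD da dai)) (is_derive_fD
  (is_derive_fM (dc 4^-1) (is_derive_fM dB (is_derive_fD (dc 1) dai)))
  (is_derive_fD
    (is_derive_fM (dc 32^-1) (is_derive_fM (is_derive_fM dB dB) dai))
    (is_derive_fM (dc 2^-1) (is_derive_fM dZ dai)))))) => /=.
by field.
Qed.

Local Notation F := (@cosh_dist R mu nu).

Lemma frame_a_cosh_dist p : DRset p ->
  DX idx_a F p = (p.2 - p.2^-1) / 2 - dotp p.1.1 p.1.1 / (4 * p.2)
    - dotp p.1.1 p.1.1 ^+ 2 / (32 * p.2) - dotp p.1.2 p.1.2 / (2 * p.2).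
Proof.
move=> p0; have a0 : p.2 != 0 by exact: lt0r_neq0.
rewrite (frame_deriveE (is_derive_cosh_dist _ p0)).
by rewrite frame_aE /= !dotp0; field.
Qed.

Lemma frame_x_cosh_dist l p : DRset p -> DX (idx_x l) F p =
  root_a p * ((1 + p.2^-1) / 2 + dotp p.1.1 p.1.1 / (8 * p.2)) * p.1.1 l 0
  + root_a p / (2 * p.2) * (J p.1.2 *m p.1.1) l 0.
Proof.
move=> p0; have a0 : p.2 != 0 by exact: lt0r_neq0.
rewrite (frame_deriveE (is_derive_cosh_dist _ p0)).
rewrite frame_xE /= mul0r add0r !dotpZr dotp_bracket !dotp_delta.
by rewrite -[Num.sqrt _]/(root_a p); field.
Qed.

Lemma frame_z_cosh_dist k p : DRset p -> DX (idx_z k) F p = p.1.2 k 0.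
Proof.
move=> p0; have a0 : p.2 != 0 by exact: lt0r_neq0.
rewrite (frame_deriveE (is_derive_cosh_dist _ p0)).
by rewrite frame_zE /= mul0r add0r !dotpZr dotp_delta dotp0; field.
Qed.

(** The x-part of the gradient is a combination of x and J_z x, two orthogonal
    vectors of squared norms |x|^2 and |z|^2 |x|^2, so its norm only depends on
    a, |x|^2 and |z|^2.  The identity is cosh'(r)^2 = sinh(r)^2, that is
    |grad r| = 1. *)
Lemma gradient_cosh_dist p : DRset p ->
  \sum_i (DX i F p) ^+ 2 = F p ^+ 2 - 1.
Proof.
move=> p0; have a0 : p.2 != 0 by exact: lt0r_neq0.
rewrite big_idx frame_a_cosh_dist//; under eq_bigr do rewrite frame_x_cosh_dist//.
under [X in _ + (_ + X)]eq_bigr do rewrite frame_z_cosh_dist//.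
set B := dotp p.1.1 p.1.1; set Z := dotp p.1.2 p.1.2; set a := p.2 in a0 *.
set y := J p.1.2 *m p.1.1.
set c1 := root_a p * _; set c2 := root_a p / _.
have -> : \sum_i p.1.2 i 0 ^+ 2 = Z by apply: eq_bigr => i _; rewrite expr2.
have -> : \sum_i (c1 * p.1.1 i 0 + c2 * y i 0) ^+ 2 = c1 ^+ 2 * B + c2 ^+ 2 * (Z * B).
  transitivity (dotp (c1 *: p.1.1 + c2 *: y) (c1 *: p.1.1 + c2 *: y)).
    by apply: eq_bigr => i _; rewrite expr2 !mxE.
  rewrite !(dotpDl, dotpDr, dotpZl, dotpZr) J_dot -/B -/Z.
  rewrite [dotp p.1.1 y]dotpC J_dot0; ring.
rewrite cosh_distE// -/a -/B -/Z /c1 /c2 !exprMn [root_a p ^+ 2]expr2 root_aK// -/a.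
by field.
Qed.

(** This turns directional derivatives into scalar products for the Riemannian
    metric, the frame being orthonormal. *)
Lemma derive_cosh_dist_coframe p v : DRset p ->
  'D_v F p = \sum_i coframe J i p v * DX i F p.
Proof.
move=> p0; have a0 : p.2 != 0 by exact: lt0r_neq0.
have r0 := root_a_neq0 p0.
have ca : coframe J idx_a p v = v.2 / p.2 by rewrite /coframe (unsplitK (inl _)).
have cx l : coframe J (idx_x l) p v = v.1.1 l 0 / root_a p.
  by rewrite /coframe (unsplitK (inr _)) (unsplitK (inl _)).
have cz k : coframe J (idx_z k) p v = (v.1.2 - 2^-1 *: bracket J p.1.1 v.1.1) k 0 / p.2.
  by rewrite /coframe !(unsplitK (inr _)).
rewrite big_idx ca frame_a_cosh_dist//.
under eq_bigr do rewrite cx frame_x_cosh_dist//.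
under [X in _ + (_ + X)]eq_bigr do rewrite cz frame_z_cosh_dist//.
set B := dotp p.1.1 p.1.1; set Z := dotp p.1.2 p.1.2.
set y := J p.1.2 *m p.1.1; set w := v.1.2 - _.
set c1 := root_a p * _; set c2 := root_a p / _.
have -> : \sum_k w k 0 / p.2 * p.1.2 k 0 = dotp (p.2^-1 *: w) p.1.2.
  by rewrite dotpZl /dotp mulr_sumr; apply: eq_bigr => k _; ring.
have -> : \sum_i v.1.1 i 0 / root_a p * (c1 * p.1.1 i 0 + c2 * y i 0) =
    dotp ((root_a p)^-1 *: v.1.1) (c1 *: p.1.1 + c2 *: y).
  by apply: eq_bigr => i _; rewrite !mxE; ring.
rewrite (derive_val (is_derive := is_derive_cosh_dist _ p0)) /= -/B -/Z.
rewrite /w !(dotpDl, dotpDr, dotpNl, dotpZl, dotpZr) [dotp (bracket _ _ _) _]dotpC.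
rewrite dotp_bracket -/y [dotp v.1.1 y]dotpC [dotp v.1.1 p.1.1]dotpC.
rewrite [dotp v.1.2 p.1.2]dotpC.
by rewrite /c1 /c2; field; rewrite a0 r0.
Qed.

End Gradient.

(** * Symbols *)

Section Symbols.
Context {R : realType} {mu nu : nat} (J : {linear 'cV[R]_nu -> 'M[R]_mu}).
Hypothesis J_skew : forall z, (J z)^T = - J z.
Hypothesis J_orth : forall z, enorm z = 1 -> (J z)^T *m J z = 1%:M.
Local Notation DR := (ambient R mu nu).
Local Notation DX i f := (frame_derive J i f).
Local Notation F := (@cosh_dist R mu nu).
Implicit Types (p v : DR) (f g : DR -> R).

(** By [cosh_dist_gt1] this is S without the identity; the condition on F is
    visibly open. *)
Definition punctured p := DRset p /\ 1 < F p.

Definition sinh_dist p : R := Num.sqrt (F p ^+ 2 - 1).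
(** arcosh F, in logarithmic form. *)
Definition dist_formula p : R := ln (F p + sinh_dist p).
Local Notation sigma := sinh_dist.

Lemma differentiable_cosh_dist p : DRset p -> differentiable F p.
Proof. exact: order_one_differentiable (@order_one_cosh_dist R mu nu) p. Qed.

Lemma near_punctured p : punctured p -> \forall q \near p, punctured q.
Proof.
move=> [p0 p1]; have Fc := differentiable_continuous (differentiable_cosh_dist p0).
apply: filterI; first exact: near_DRset.
by move/cvgr_gt: Fc; apply.
Qed.

Lemma sinh_dist_gt0 p : punctured p -> 0 < sigma p.
Proof. by move=> [p0 p1]; rewrite sqrtr_gt0 subr_gt0 exprn_egt1. Qed.

Lemma sinh_dist_sqr p : DRset p -> sigma p ^+ 2 = F p ^+ 2 - 1.
Proof. by move=> p0; rewrite sqr_sqrtr// subr_ge0 exprn_ege1// cosh_dist_ge1. Qed.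

Lemma cosh_dist_gt0 p : DRset p -> 0 < F p.
Proof. by move=> p0; apply: lt_le_trans (cosh_dist_ge1 p0). Qed.

Lemma sinh_dist_le p : DRset p -> sigma p <= F p.
Proof.
move=> p0; rewrite -(ler_pXn2r (ltn0Sn 1)) ?nnegrE ?sqrtr_ge0 ?sinh_dist_sqr//.
  by rewrite gerBl.
exact/ltW/cosh_dist_gt0.
Qed.

(** Adding e > 0 under the square root removes the singularity of the
    logarithm below at the identity; the value e = 0 gives [sinh_dist] and
    [dist_formula]. *)
Definition sinh_reg (e : R) p : R := Num.sqrt (F p ^+ 2 - 1 + e).
Definition dist_reg (e : R) p : R := ln (F p + sinh_reg e p).

Lemma is_derive_sinh_reg e p v : DRset p -> 0 < F p ^+ 2 - 1 + e ->
  differentiable (sinh_reg e) p /\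
  is_derive p v (sinh_reg e) (F p * 'D_v F p / sinh_reg e p).
Proof.
move=> p0 s0; have dF := differentiable_cosh_dist p0.
have DF : is_derive p v F ('D_v F p) by apply/derivableP/diff_derivable.
pose G q := F q * F q + (e - 1).
have GE q : F q ^+ 2 - 1 + e = G q by rewrite /G; ring.
have dG : differentiable G p.
  apply: (@differentiableD _ _ _ (fun q => F q * F q) (cst (e - 1))) => //.
  by apply: (@differentiableM _ _ F F).
have DG : is_derive p v G (2 * F p * 'D_v F p).
  have dc : is_derive p v (fun=> e - 1) 0 by exact: is_derive_cst.
  apply: (is_derive_eq (is_derive_fD (is_derive_fM DF DF) dc)).
  by ring.
have -> : sinh_reg e = fun q => Num.sqrt (G q).
  by apply/funext => q; rewrite /sinh_reg GE.
rewrite GE in s0; split; first exact: differentiable_sqrt_comp.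
apply: is_derive_eq.
  exact: (is_derive_comp1 (h := Num.sqrt) dG (is_derive1_sqrt s0) DG).
by field; rewrite lt0r_neq0// sqrtr_gt0.
Qed.

Lemma is_derive_dist_reg e p v : DRset p -> 0 < F p ^+ 2 - 1 + e ->
  differentiable (dist_reg e) p /\
  is_derive p v (dist_reg e) ('D_v F p / sinh_reg e p).
Proof.
move=> p0 s0; have dF := differentiable_cosh_dist p0.
have DF : is_derive p v F ('D_v F p) by apply/derivableP/diff_derivable.
have [dS DS] := is_derive_sinh_reg v p0 s0.
have r0 : 0 < sinh_reg e p by rewrite sqrtr_gt0.
have H0 : 0 < F p + sinh_reg e p by rewrite addr_gt0 ?cosh_dist_gt0.
have dH : differentiable (fun q => F q + sinh_reg e q) p.
  by apply: (@differentiableD _ _ _ F (sinh_reg e)).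
split; first exact: (differentiable_ln_comp dH).
apply: (is_derive_eq (is_derive_comp1 (h := @ln R) dH (is_derive1_ln H0)
  (is_derive_fD DF DS))).
by field; rewrite !lt0r_neq0.
Qed.

Lemma sinh_reg0 : sinh_reg 0 = sigma.
Proof. by apply/funext => p; rewrite /sinh_reg addr0. Qed.

Lemma dist_reg0 : dist_reg 0 = dist_formula.
Proof. by apply/funext => p; rewrite /dist_reg sinh_reg0. Qed.

Lemma is_derive_dist_formula p v : punctured p ->
  differentiable dist_formula p /\
  is_derive p v dist_formula ('D_v F p / sigma p).
Proof.
move=> pp; rewrite -dist_reg0 -sinh_reg0; apply: is_derive_dist_reg.
  by case: pp.
by rewrite addr0 -sqrtr_gt0; exact: sinh_dist_gt0.
Qed.

Lemma is_derive_sinh_dist p v : punctured p ->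
  differentiable sigma p /\ is_derive p v sigma (F p * 'D_v F p / sigma p).
Proof.
move=> pp; rewrite -sinh_reg0; apply: is_derive_sinh_reg; first by case: pp.
by rewrite addr0 -sqrtr_gt0; exact: sinh_dist_gt0.
Qed.

(** One term of the sum in [gradient_cosh_dist] is at most the sum. *)
Lemma frame_derive_le_sinh i p : DRset p -> `|DX i F p| <= sigma p.
Proof.
move=> p0; rewrite -(ler_pXn2r (ltn0Sn 1)) ?nnegrE ?sqrtr_ge0// sinh_dist_sqr//.
rewrite -(gradient_cosh_dist J_skew J_orth p0) (bigD1 i)//= real_normK ?num_real//.
by rewrite lerDl sumr_ge0// => j _; exact: sqr_ge0.
Qed.

(** A symbol of order m is to be O((F / s)^m), with s = sinh r.  The quotients
    X_i F / s are singled out because first derivatives of F vanish at the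
    identity like s does, and so gain one order over a general f / s. *)
Inductive symbol : nat -> (DR -> R) -> Prop :=
| symbol_grad i : symbol 0 (fun p => DX i F p / sigma p)
| symbol_order_one f : order_one f -> symbol 1 (fun p => f p / sigma p)
| symbol_add m f g : symbol m f -> symbol m g -> symbol m (fun p => f p + g p)
| symbol_opp m f : symbol m f -> symbol m (fun p => - f p)
| symbol_mul m n f g : symbol m f -> symbol n g ->
    symbol (m + n) (fun p => f p * g p)
| symbol_weak m f : symbol m f -> symbol m.+1 f
| symbol_ext m f g : (forall p, punctured p -> f p = g p) ->
    symbol m f -> symbol m g.

Lemma differentiable_quotient f p : order_one f -> punctured p ->
  differentiable (fun q => f q / sigma q) p.
Proof.
move=> qf pp; have [p0 p1] := pp.
apply: (@differentiableM _ _ f (fun q => (sigma q)^-1)).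
  exact: order_one_differentiable.
apply: differentiableV; last by rewrite lt0r_neq0// sinh_dist_gt0.
by have [] := is_derive_sinh_dist 0 pp.
Qed.

Lemma frame_derive_quotient i f p : order_one f -> punctured p ->
  DX i (fun q => f q / sigma q) p =
  DX i f p / sigma p - (f p / sigma p) * ((F p / sigma p) * (DX i F p / sigma p)).
Proof.
move=> qf pp; have [p0 p1] := pp; have s0 := lt0r_neq0 (sinh_dist_gt0 pp).
have [ds Ds] := is_derive_sinh_dist (frame J i p) pp.
have Df : is_derive p (frame J i p) f (DX i f p).
  by apply/derivableP/diff_derivable/order_one_differentiable.
have Dsi : is_derive p (frame J i p) (fun q => (sigma q)^-1)
    (- (F p * DX i F p) / sigma p ^+ 3).
  have ds' : derivable sigma p (frame J i p) by exact: diff_derivable.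
  apply: DeriveDef; first exact: (derivableV (f := sigma)).
  rewrite (deriveV (f := sigma))//.
  by rewrite (derive_val (is_derive := Ds)) /GRing.scale/= /frame_derive; field.
rewrite (frame_deriveE (is_derive_fM Df Dsi)).
by field.
Qed.

Lemma order_one_frame_cosh i : order_one (DX i F).
Proof. exact/order_one_frame_derive/order_one_cosh_dist. Qed.

Lemma symbol_differentiable m f : symbol m f ->
  forall p, punctured p -> differentiable f p.
Proof.
elim=> {m f} [i|f qf|m f g _ IHf _ IHg|m f _ IHf|m n f g _ IHf _ IHg|//|m f g fg _ IHf] p pp.
- exact: differentiable_quotient (order_one_frame_cosh i) pp.
- exact: differentiable_quotient.
- by apply: (@differentiableD _ _ _ f g); [exact: IHf|exact: IHg].
- by apply: (@differentiableN _ _ _ f); exact: IHf.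
- by apply: (@differentiableM _ _ f g); [exact: IHf|exact: IHg].
- apply: near_differentiable (IHf _ pp).
  by apply: filterS (near_punctured pp) => q; exact: fg.
Qed.

(** In the quotient rule for f / s the correction term is the product of f / s
    and of the symbol (F / s) (X_i F / s), whose order is 1.  For f = X_j F the main term
    X_i X_j F / s also has order 1 exactly, so the order 0 rises to 1. *)
Lemma symbol_frame_derive i m f : symbol m f -> symbol m.+1 (DX i f).
Proof.
have Q g : order_one g -> symbol 1 (fun p => DX i g p / sigma p).
  by move=> qg; apply/symbol_order_one/order_one_frame_derive.
have K n g : symbol n (fun p => g p / sigma p) ->
    symbol n.+1 (fun p => - ((g p / sigma p) * ((F p / sigma p) * (DX i F p / sigma p)))).
  move=> sg; apply: symbol_opp; have <- : (n + 1 = n.+1)%N by rewrite addn1.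
  apply: (symbol_mul sg (symbol_mul (m := 1) _ (symbol_grad i))).
  exact/symbol_order_one/order_one_cosh_dist.
elim=> {m f} [j|f qf|m f g sf IHf sg IHg|m f sf IHf|m n f g sf IHf sg IHg
  |m f sf IHf|m f g fg sf IHf].
- apply: symbol_ext (symbol_add (Q _ (order_one_frame_cosh j)) (K _ _ (symbol_grad j))).
  by move=> p pp; rewrite frame_derive_quotient//; exact: order_one_frame_cosh.
- apply: symbol_ext (symbol_add (symbol_weak (Q _ qf)) (K _ _ (symbol_order_one qf))).
  by move=> p pp; rewrite frame_derive_quotient.
- apply: symbol_ext (symbol_add IHf IHg) => p pp; rewrite /frame_derive.
  have /diff_derivable df := symbol_differentiable sf pp.
  have /diff_derivable dg := symbol_differentiable sg pp.
  by rewrite [RHS](@deriveD _ _ _ f g).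
- apply: symbol_ext (symbol_opp IHf) => p pp; rewrite /frame_derive.
  have /diff_derivable df := symbol_differentiable sf pp.
  by rewrite [RHS](@deriveN _ _ _ f).
- have H1 := symbol_mul sf IHg; have H2 := symbol_mul IHf sg.
  rewrite addnS in H1; rewrite addSn in H2.
  apply: symbol_ext (symbol_add H1 H2) => p pp; rewrite /frame_derive.
  have /diff_derivable df := symbol_differentiable sf pp.
  have /diff_derivable dg := symbol_differentiable sg pp.
  rewrite [RHS](@deriveM _ _ f g)//= /GRing.scale/=; congr (_ + _).
  by rewrite mulrC.
- exact: symbol_weak.
- apply: symbol_ext IHf => p pp; apply: frame_derive_near.
  by apply: filterS (near_punctured pp) => q; exact: fg.
Qed.

Lemma symbol_bound m f : symbol m f ->
  exists2 C, 0 <= C & forall p, punctured p -> `|f p| <= C * (F p / sigma p) ^+ m.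
Proof.
have coth1 p : punctured p -> 1 <= F p / sigma p.
  move=> pp; have [p0 p1] := pp.
  by rewrite ler_pdivlMr ?sinh_dist_gt0// mul1r sinh_dist_le.
elim=> {m f} [i|f qf|m f g _ [C C0 fC] _ [D D0 gD]|m f _ [C C0 fC]
  |m n f g _ [C C0 fC] _ [D D0 gD]|m f _ [C C0 fC]|m f g fg _ [C C0 fC]].
- exists 1 => // p pp; have [p0 p1] := pp; have s0 := sinh_dist_gt0 pp.
  rewrite mul1r normrM normfV (gtr0_norm s0) ler_pdivrMr// mul1r.
  exact: frame_derive_le_sinh.
- have [C fC] := order_one_bound qf; exists `|C| => // p pp; have [p0 p1] := pp.
  have s0 := sinh_dist_gt0 pp.
  rewrite expr1 normrM normfV (gtr0_norm s0) mulrA ler_pM2r ?invr_gt0//.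
  rewrite (le_trans (fC _ p0))// ler_wpM2r ?ler_norm//.
  exact/ltW/cosh_dist_gt0.
- exists (C + D) => [|p pp]; first exact: addr_ge0.
  by rewrite (le_trans (ler_normD _ _))// mulrDl lerD ?fC ?gD.
- by exists C => // p pp; rewrite normrN fC.
- exists (C * D) => [|p pp]; first exact: mulr_ge0.
  by rewrite normrM exprD mulrACA ler_pM ?fC ?gD.
- exists C => // p pp; rewrite (le_trans (fC _ pp))// ler_wpM2l//.
  by rewrite exprS ler_peMl ?coth1// exprn_ge0// (le_trans ler01)// coth1.
- by exists C => // p pp; rewrite -fg ?fC.
Qed.

(** The innermost derivative X_i r = X_i F / s has order 0, and each of the
    others raises the order by 1. *)
Lemma symbol_frame_derives_dist s i :
  symbol (size s) (frame_derives J (rcons s i) dist_formula).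
Proof.
elim: s => [|j s IHs] /=; last exact: symbol_frame_derive.
apply: symbol_ext (symbol_grad i) => p pp /=; rewrite /frame_derive.
by have [_ D] := is_derive_dist_formula (frame J i p) pp; rewrite (derive_val (is_derive := D)).
Qed.

Lemma expR_dist p : DRset p -> expR (dist_formula p) = F p + sigma p.
Proof.
move=> p0; rewrite lnK// posrE ltr_pwDl ?cosh_dist_gt0// sqrtr_ge0 //.
Qed.

Lemma dist_formula_gt0 p : punctured p -> 0 < dist_formula p.
Proof.
move=> pp; have [p0 p1] := pp; rewrite ln_gt0// ltr_wpDr//.
exact/ltW/sinh_dist_gt0.
Qed.

(** With E = exp r one has coth r = 1 + 2 / (E^2 - 1), and E^2 >= 1 + 2 r.  In
    the proof 1 / E = F - s is the factor that clears denominators. *)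
Lemma coth_dist_le p : punctured p ->
  F p / sigma p <= (1 + dist_formula p) / dist_formula p.
Proof.
move=> pp; have [p0 p1] := pp; have s0 := sinh_dist_gt0 pp.
have r0 := dist_formula_gt0 pp.
rewrite ler_pdivrMr// mulrAC ler_pdivlMr// -subr_ge0.
have E := expR_ge1Dx (2 * dist_formula p).
rewrite expRM_natl expR_dist// in E.
have S := sinh_dist_sqr p0; set r := dist_formula p in E r0 *.
have F0 := cosh_dist_gt0 p0.
have : 0 <= (F p - sigma p) * ((F p + sigma p) ^+ 2 - (1 + 2 * r)).
  by rewrite mulr_ge0// subr_ge0 ?sinh_dist_le.
suff -> : (F p - sigma p) * ((F p + sigma p) ^+ 2 - (1 + 2 * r)) =
   2 * ((1 + r) * sigma p - F p * r) by rewrite pmulr_rge0.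
transitivity ((F p ^+ 2 - sigma p ^+ 2) * (F p + sigma p) - (F p - sigma p) * (1 + 2 * r)).
  by ring.
rewrite S; ring.
Qed.

End Symbols.

(** * Curves are at least as long as arcosh F *)

Section LowerBound.
Context {R : realType} {mu nu : nat} (J : {linear 'cV[R]_nu -> 'M[R]_mu}).
Hypothesis J_skew : forall z, (J z)^T = - J z.
Hypothesis J_orth : forall z, enorm z = 1 -> (J z)^T *m J z = 1%:M.
Local Notation DR := (ambient R mu nu).
Local Notation DX i f := (frame_derive J i f).
Local Notation F := (@cosh_dist R mu nu).
Implicit Types (p v : DR) (f : DR -> R) (g : R -> DR).

(** The regularised distance has a gradient of norm at most 1, by
    Cauchy-Schwarz and [gradient_cosh_dist]. *)
Lemma derive_dist_reg_le e p v : DRset p -> 0 < e ->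
  `|'D_v F p / Num.sqrt (F p ^+ 2 - 1 + e)| <= Num.sqrt (metric J p v v).
Proof.
move=> p0 e0; have F1 : 0 <= F p ^+ 2 - 1.
  by rewrite subr_ge0 exprn_ege1// cosh_dist_ge1.
have s0 : 0 < Num.sqrt (F p ^+ 2 - 1 + e) by rewrite sqrtr_gt0 ltr_wpDl.
rewrite normrM normfV (gtr0_norm s0) ler_pdivrMr// -sqrtrM; last first.
  by apply: sumr_ge0 => i _; rewrite -expr2 sqr_ge0.
rewrite -sqrtr_sqr ler_wsqrtr// (derive_cosh_dist_coframe J)//.
apply: le_trans (cauchy_schwarz _ _) _.
rewrite (gradient_cosh_dist J_skew J_orth p0) ler_pM//.
- by apply: sumr_ge0 => i _; rewrite sqr_ge0.
- by rewrite lerDl ltW.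
Qed.

Lemma continuous_coordx g t i : {for t, continuous g} ->
  {for t, continuous (fun s => (g s).1.1 i 0)}.
Proof.
move=> gc; apply: (continuous_comp (g := coordx i)) => //.
exact/differentiable_continuous/differentiable_coordx.
Qed.

Lemma continuous_coordz g t i : {for t, continuous g} ->
  {for t, continuous (fun s => (g s).1.2 i 0)}.
Proof.
move=> gc; apply: (continuous_comp (g := coordz i)) => //.
exact/differentiable_continuous/differentiable_coordz.
Qed.

Lemma continuous_coorda g t : {for t, continuous g} ->
  {for t, continuous (fun s => (g s).2)}.
Proof.
move=> gc; apply: (continuous_comp (g := snd)) => //.
exact/differentiable_continuous/differentiable_a.
Qed.

Lemma continuous_coframe i g g' t : DRset (g t) ->
  {for t, continuous g} -> {for t, continuous g'} ->
  {for t, continuous (fun s => coframe J i (g s) (g' s))}.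
Proof.
move=> g0 gc g'c; have a0 : (g t).2 != 0 by exact: lt0r_neq0.
have ca := continuous_coorda gc.
elim/(@idx_case mu nu): i => [|l|k]; rewrite /coframe.
- rewrite (unsplitK (inl _)).
  by apply: continuous_fM; [exact: continuous_coorda|exact: continuous_fV].
- rewrite (unsplitK (inr _)) (unsplitK (inl _)).
  apply: continuous_fM; first exact: continuous_coordx.
  apply: continuous_fV; first exact: (root_a_neq0 g0).
  apply: (continuous_comp (g := Num.sqrt)) ca _.
  by apply: sqrt_continuous.
- rewrite !(unsplitK (inr _)).
  apply: continuous_fM; last exact: continuous_fV.
  have -> : (fun s => ((g' s).1.2 - 2^-1 *: bracket J (g s).1.1 (g' s).1.1) k 0) =
    (fun s => (g' s).1.2 k 0 - 2^-1 * \sum_i (\sum_j J (delta_mx k 0) i j * (g s).1.1 j 0) * (g' s).1.1 i 0).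
    apply/funext => s; rewrite !mxE; congr (_ - _ * _).
    by apply: eq_bigr => i _; rewrite mxE.
  apply: continuous_fB; first exact: continuous_coordz.
  apply: continuous_fM; first exact: continuous_fc.
  apply: continuous_sumr => i; apply: continuous_fM; last exact: continuous_coordx.
  apply: continuous_sumr => j; apply: continuous_fM; first exact: continuous_fc.
  exact: continuous_coordx.
Qed.

Lemma continuous_speed g t : DRset (g t) -> {for t, continuous g} ->
  {for t, continuous (fun t => 'D_1 g t)} -> {for t, continuous (speed J g)}.
Proof.
move=> g0 gc g'c; apply: (continuous_comp (g := Num.sqrt)); last exact: sqrt_continuous.
by apply: continuous_sumr => i; apply: continuous_fM; exact: continuous_coframe.
Qed.

(** The derivative of the regularised distance along the arc is bounded by the
    speed; integrate it by the fundamental theorem of calculus.  The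
    regularisation allows the arc to pass through the identity. *)
Lemma dist_reg_arc e g : 0 < e -> C1_arc g ->
  dist_reg e (g 0) - dist_reg e (g 1) <= arc_length J g.
Proof.
move=> e0 [dg cg g0].
have F1 p : DRset p -> 0 < F p ^+ 2 - 1 + e.
  by move=> p0; rewrite ltr_wpDl// subr_ge0 exprn_ege1// cosh_dist_ge1.
pose G p v := 'D_v F p / Num.sqrt (F p ^+ 2 - 1 + e).
pose h t := - dist_reg e (g t).
pose h' t := - G (g t) ('D_1 g t).
have gc t : {for t, continuous g} by exact: derivable_continuous1.
have Dh (t : R) : 0 <= t <= 1 -> is_derive t 1 h (h' t).
  move=> t01; have gt0 := g0 _ t01.
  have [dP DP] := is_derive_dist_reg ('D_1 g t) gt0 (F1 _ gt0).
  have := is_derive_along dP (dg t); rewrite (derive_val (is_derive := DP)).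
  exact: is_deriveN.
have h'c (t : R) : 0 <= t <= 1 -> {for t, continuous h'}.
  move=> t01; have gt0 := g0 _ t01.
  have ng : \forall s \near t, DRset (g s) by exact: gc (near_DRset gt0).
  suff : {for t, continuous (fun s => 'D_('D_1 g s) F (g s)
      * (Num.sqrt (F (g s) ^+ 2 - 1 + e))^-1)} by move=> c; exact: cvgN.
  have dF : {for t, continuous (fun s => F (g s))}.
    apply: (continuous_comp (g := F)) => //.
    exact/differentiable_continuous/differentiable_cosh_dist.
  apply: continuous_fM; last first.
    apply: continuous_fV; first by rewrite lt0r_neq0// sqrtr_gt0 F1.
    apply: (continuous_comp (g := Num.sqrt)); last exact: sqrt_continuous.
    have -> : (fun s => F (g s) ^+ 2 - 1 + e) = (fun s => F (g s) * F (g s) - (1 - e)).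
      by apply/funext => s; ring.
    apply: continuous_fB; last exact: continuous_fc.
    exact: continuous_fM.
  have E : \forall s \near t, \sum_i coframe J i (g s) ('D_1 g s) * DX i F (g s) = 'D_('D_1 g s) F (g s).
    by apply: filterS ng => s gs; rewrite (derive_cosh_dist_coframe J)//.
  have c : {for t, continuous (fun s => \sum_i coframe J i (g s) ('D_1 g s) * DX i F (g s))}.
    apply: continuous_sumr => i; apply: (continuous_fM (f := fun s => coframe J i (g s) ('D_1 g s))).
      have := @continuous_coframe i g (fun s => 'D_1 g s) t gt0 (gc t) (cg t).
      exact.
    apply: (continuous_comp (g := DX i F)) => //.
    apply/differentiable_continuous/order_one_differentiable => //.
    exact: order_one_frame_cosh.
  rewrite /prop_for /continuous_at /= -(nbhs_singleton E).
  exact: cvg_trans (near_eq_cvg E) c.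
have within (f : R -> R) : (forall t : R, 0 <= t <= 1 -> {for t, continuous f}) ->
    {within `[0, 1], continuous f}.
  move=> fc; apply: continuous_in_subspaceT => t /set_mem /=.
  by rewrite in_itv/=; exact: fc.
have hc (t : R) : 0 <= t <= 1 -> {for t, continuous h}.
  move=> /Dh[+ _]; move/derivable1_diffP; exact: differentiable_continuous.
have hw := within _ h'c.
have sw : {within `[0, 1], continuous (speed J g)}.
  by apply: within => t t01; exact: (continuous_speed (g0 _ t01) (gc t) (cg t)).
have FTC : \int[lebesgue_measure]_(t in `[0, 1]) h' t = h 1 - h 0.
  rewrite /Rintegral (@continuous_FTC2 _ h' h)//.
    split.
    - by move=> t /[!in_itv]/= /andP[a b]; apply: ex_derive; apply: Dh; rewrite !ltW.
    - apply: cvg_at_right_filter; by apply: hc; rewrite lexx ler01.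
    - apply: cvg_at_left_filter; by apply: hc; rewrite lexx ler01.
  move=> t /[!in_itv]/= /andP[a b]; rewrite derive1E.
  by apply: derive_val; apply: Dh; rewrite !ltW.
have -> : dist_reg e (g 0) - dist_reg e (g 1) = h 1 - h 0 by rewrite /h opprK addrC.
rewrite -FTC; apply: le_Rintegral => //.
- by apply: continuous_compact_integrable => //; exact: segment_compact.
- by apply: continuous_compact_integrable => //; exact: segment_compact.
- move=> t /=; rewrite in_itv/= => t01.
  apply: le_trans (derive_dist_reg_le _ (g0 _ t01) e0).
  by rewrite /h' -/(G _ _) -normrN ler_norm.
Qed.

Lemma sqrtrD_le (a b : R) : 0 <= a -> 0 <= b ->
  Num.sqrt (a + b) <= Num.sqrt a + Num.sqrt b.
Proof.
move=> a0 b0; have := sqrtr_ge0 a; have := sqrtr_ge0 b => sb sa.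
rewrite -[leRHS]ger0_norm ?addr_ge0// -sqrtr_sqr ler_wsqrtr//.
by rewrite sqrrD !sqr_sqrtr// lerD2r lerDl mulrn_wge0// mulr_ge0.
Qed.

(** Limit of [dist_reg_arc]: with e = d^2 the regularised distance lies between
    arcosh F and arcosh F + d. *)
Lemma dist_formula_arc g : C1_arc g ->
  dist_formula (g 0) <= dist_formula (g 1) + arc_length J g.
Proof.
move=> cg; have g0 : DRset (g 0) by case: cg => _ _; apply; rewrite lexx ler01.
have g1 : DRset (g 1) by case: cg => _ _; apply; rewrite lexx ler01.
apply/ler_addgt0Pr => d d0.
have := dist_reg_arc (exprn_gt0 2 d0) cg.
have F1 p : DRset p -> 0 <= F p ^+ 2 - 1.
  by move=> p0; rewrite subr_ge0 exprn_ege1// cosh_dist_ge1.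
have lower : dist_formula (g 0) <= dist_reg (d ^+ 2) (g 0).
  rewrite /dist_formula /dist_reg ler_ln; first last.
  - by rewrite posrE ltr_pwDl ?sqrtr_ge0 ?cosh_dist_gt0.
  - by rewrite posrE ltr_pwDl ?sqrtr_ge0 ?cosh_dist_gt0.
  rewrite lerD2l ler_wsqrtr//.
  by rewrite lerDl sqr_ge0.
have upper : dist_reg (d ^+ 2) (g 1) <= dist_formula (g 1) + d.
  have E0 : 1 <= F (g 1) + sinh_dist (g 1).
    by rewrite (le_trans (cosh_dist_ge1 g1))// lerDl sqrtr_ge0.
  have E1 := lt_le_trans ltr01 E0.
  rewrite -[leRHS]expRK /dist_reg ler_ln ?posrE ?expR_gt0//; last first.
    by rewrite ltr_pwDl ?sqrtr_ge0 ?cosh_dist_gt0.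
  rewrite expRD expR_dist//.
  apply: (@le_trans _ _ (F (g 1) + (sinh_dist (g 1) + d))).
    rewrite lerD2l (le_trans (sqrtrD_le _ _))// ?F1 ?sqr_ge0//.
    by rewrite sqrtr_sqr gtr0_norm.
  rewrite addrA; apply: (@le_trans _ _ ((F (g 1) + sinh_dist (g 1)) * (1 + d))).
    by rewrite mulrDr mulr1 lerD2l ler_peMl// ltW.
  by rewrite ler_wpM2l ?expR_ge1Dx// ltW.
lra.
Qed.

Lemma dist_formula_joined p q l : joined J p q l ->
  dist_formula p <= dist_formula q + l.
Proof.
elim=> {p q l} [g cg|p q s l m _ IH1 _ IH2]; first exact: dist_formula_arc.
lra.
Qed.

Lemma dist_formula1 : dist_formula (DRone mu nu : DR) = 0.
Proof.
have F1 : F (DRone mu nu) = 1 :> R.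
  apply/eqP; rewrite -subr_eq0 cosh_distB1; last exact: ltr01.
  by rewrite /= !dotp0 mul0r !addr0 subrr expr0n /= mul0r.
by rewrite /dist_formula /sinh_dist F1 expr1n subrr sqrtr0 addr0 ln1.
Qed.

End LowerBound.

(** * The geodesic to the identity *)

Section GeodesicAlgebra.
Context {R : realType}.

(** The speed of [geodesic] below, with denominators cleared: D, P, H and W stand
    for its denominator and numerators, and dD, dP, dH and dW for their
    derivatives when c' = w q s and s' = w c.  The curves in question satisfy
    K = 1; keeping the powers of K makes both sides homogeneous in c and s, so
    that they agree identically. *)
Lemma geodesic_identity (c s b k q w : R) :
  let m := 2 * k + 2 * b - 1 in let Z := (m - b ^+ 2) / k ^+ 2 in
  let B := 2 * (q - m) / k in
  let D := c * c - 2 * b * c * s + m * s * s in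
  let dD := 2 * w * (q * s * c - b * (c * c + q * s * s) + m * s * c) in
  let P := s * (c * (1 - b) + s * (m - b)) in
  let dP := w * (c * (c * (1 - b) + s * (m - b)) + s * (q * s * (1 - b) + c * (m - b))) in
  let H := k * s * (s - c) in
  let dH := k * w * (c * (s - c) + s * (c - q * s)) in
  let W := 2 * k * c * s in
  let dW := 2 * k * w * (c * c + q * s * s) in
  let K := c * c - q * s * s in
  k != 0 ->
  dD ^+ 2 * D * K ^+ 2
  + ((dP * D - P * dD) ^+ 2 + (dH * D - H * dD) ^+ 2 * Z) * B * K
  + (dW * D - W * dD - 2^-1 * (P * dH - H * dP) * B) ^+ 2 * Z * D
  = 4 * q * w ^+ 2 * D ^+ 3 * K ^+ 2.
Proof.
move=> m Z B D dD P dP H dH W dW K k0.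
rewrite /dD /dP /dH /dW /P /H /W /Z /B /D /m /K.
by field.
Qed.

End GeodesicAlgebra.

Section Curve.
Context {R : realType} {mu nu : nat} (J : {linear 'cV[R]_nu -> 'M[R]_mu}).
Hypothesis J_skew : forall z, (J z)^T = - J z.
Hypothesis J_orth : forall z, enorm z = 1 -> (J z)^T *m J z = 1%:M.
Local Notation DR := (ambient R mu nu).

(** The plane spanned by x and J_z x is stable under J_z, and the bracket of two
    of its vectors is their area times z. *)
Lemma bracket_plane x z (a b a' b' : R) :
  bracket J (a *: x + b *: (J z *m x)) (a' *: x + b' *: (J z *m x)) =
  ((a * b' - b * a') * dotp x x) *: z.
Proof.
apply/colP => k; rewrite bracketE [RHS]mxE.
set e := delta_mx k 0; set y := J z *m x.
rewrite -[LHS]/(dotp (J e *m (a *: x + b *: y)) (a' *: x + b' *: y)).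
have ez : dotp e z = z k 0 by rewrite dotpC dotp_delta.
have xy : dotp (J e *m x) y = z k 0 * dotp x x by rewrite /y J_dot// ez.
have yx : dotp (J e *m y) x = - (z k 0 * dotp x x).
  by rewrite dotp_mulmx J_skew mulNmx dotpC dotpNl xy.
rewrite mulmxDr -!scalemxAr !(dotpDl, dotpDr, dotpZl, dotpZr) xy yx !J_dot0//.
ring.
Qed.

Lemma metricE (p v : DR) : DRset p -> metric J p v v =
  (v.2 / p.2) ^+ 2 + (dotp v.1.1 v.1.1 / p.2
  + let w := v.1.2 - 2^-1 *: bracket J p.1.1 v.1.1 in dotp w w / p.2 ^+ 2).
Proof.
move=> p0; have a0 : p.2 != 0 by exact: lt0r_neq0.
rewrite /metric big_idx -expr2; congr (_ ^+ 2 + (_ + _)).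
- by rewrite /coframe (unsplitK (inl _)).
- rewrite /dotp mulr_suml; apply: eq_bigr => l _.
  rewrite /coframe (unsplitK (inr _)) (unsplitK (inl _)) -[Num.sqrt _]/(root_a p).
  by rewrite -(root_aK p0); field; exact: root_a_neq0.
- rewrite /dotp mulr_suml; apply: eq_bigr => l _.
  by rewrite /coframe !(unsplitK (inr _)); field.
Qed.

(** On the span of x and J_z x the map J_z acts as |z| times a complex unit.  Let
    h = a + |x|^2 / 4 and u = h + J_z, the coordinate of the point in the Siegel
    domain.  Its Cayley transform is b + k J_z = (u - 1) / (u + 1), with
    k = 2 / N and N = (1 + h)^2 + |z|^2; the remaining coordinate in the ball is
    x / (1 + u).  Below m is the squared norm b^2 + k^2 |z|^2, and q is the
    squared norm m + |x|^2 / N of the whole image point, equal to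
    tanh(r / 2)^2.  The geodesic is the preimage of the ray formed by the
    multiples s/c of the image point, and m = 2 k + 2 b - 1 holds because
    |1 - (b + k J_z)|^2 = 4 / N.  The two differential equations keep
    c^2 - q s^2 constant and make s/c a multiple of a hyperbolic tangent, which
    stays inside the ball for all times and gives constant speed. *)
Variables (x : 'cV[R]_mu) (z : 'cV[R]_nu) (k b q w : R) (c s : R -> R).
Local Notation m := (2 * k + 2 * b - 1).
Hypothesis k0 : k != 0.
Hypothesis zE : dotp z z = (m - b ^+ 2) / k ^+ 2.
Hypothesis xE : dotp x x = 2 * (q - m) / k.
Hypothesis mq : m <= q.
Hypothesis csK : forall t, c t * c t - q * s t * s t = 1.
Hypothesis c_derive : forall t : R, is_derive t 1 c (w * q * s t).
Hypothesis s_derive : forall t : R, is_derive t 1 s (w * c t).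

(** Denominator and numerators obtained by applying the inverse Cayley transform
    to (s/c) times the image point and multiplying by c^2. *)
Definition den t := c t * c t + (- (2 * b) * c t * s t + m * s t * s t).
Definition den' t := 2 * w * (q * s t * c t - b * (c t * c t + q * s t * s t)
  + m * s t * c t).
Definition num_x t := s t * (c t * (1 - b) + s t * (m - b)).
Definition num_x' t := w * (c t * (c t * (1 - b) + s t * (m - b))
  + s t * (q * s t * (1 - b) + c t * (m - b))).
Definition num_Jx t := k * s t * (s t + -1 * c t).
Definition num_Jx' t := k * w * (c t * (s t - c t) + s t * (c t - q * s t)).
Definition num_z t := 2 * k * c t * s t.
Definition num_z' t := 2 * k * w * (c t * c t + q * s t * s t).

(** den is the squared modulus of c - (b + k J_z) s.  If it vanished then
    c^2 = b^2 s^2 <= q s^2, against c^2 - q s^2 = 1. *)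
Lemma den_gt0 t : 0 < den t.
Proof.
have Z0 : 0 <= m - b ^+ 2.
  have -> : m - b ^+ 2 = dotp z z * k ^+ 2 by rewrite zE; field.
  by rewrite mulr_ge0 ?dotp_ge0 ?sqr_ge0.
have DE : den t = (c t - b * s t) ^+ 2 + (m - b ^+ 2) * s t ^+ 2 by rewrite /den; ring.
have D1 : 0 <= (m - b ^+ 2) * s t ^+ 2 by apply: mulr_ge0 => //; exact: sqr_ge0.
have D0 : 0 <= den t by rewrite DE; apply: addr_ge0 => //; exact: sqr_ge0.
rewrite lt_neqAle D0 andbT eq_sym; apply/eqP.
rewrite DE => /eqP; rewrite paddr_eq0 ?sqr_ge0// sqrf_eq0 subr_eq0.
move=> /andP[/eqP cE _]; have := csK t; rewrite cE.
have : 0 <= (q - m + (m - b ^+ 2)) * s t ^+ 2.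
  by apply: mulr_ge0; [apply: addr_ge0 => //; rewrite subr_ge0|exact: sqr_ge0].
move=> H1 H2; have : (0 : R) < 0; last by rewrite ltxx.
lra.
Qed.

Let cst_derive (e t : R) : is_derive t 1 (fun=> e : R) 0.
Proof. exact: is_derive_cst. Qed.

Lemma den_derive (t : R) : is_derive t 1 den (den' t).
Proof.
have Dc := c_derive t; have Ds := s_derive t.
apply: (is_derive_eq (is_derive_fD (is_derive_fM Dc Dc) (is_derive_fD
  (is_derive_fM (is_derive_fM (cst_derive (- (2 * b)) t) Dc) Ds)
  (is_derive_fM (is_derive_fM (cst_derive m t) Ds) Ds)))).
rewrite /den'; ring.
Qed.

Lemma num_x_derive (t : R) : is_derive t 1 num_x (num_x' t).
Proof.
have Dc := c_derive t; have Ds := s_derive t.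
apply: (is_derive_eq (is_derive_fM Ds (is_derive_fD
  (is_derive_fM Dc (cst_derive (1 - b) t))
  (is_derive_fM Ds (cst_derive (m - b) t))))).
rewrite /num_x'; ring.
Qed.

Lemma num_Jx_derive (t : R) : is_derive t 1 num_Jx (num_Jx' t).
Proof.
have Dc := c_derive t; have Ds := s_derive t.
apply: (is_derive_eq (is_derive_fM (is_derive_fM (cst_derive k t) Ds)
  (is_derive_fD Ds (is_derive_fM (cst_derive (-1) t) Dc)))).
rewrite /num_Jx'; ring.
Qed.

Lemma num_z_derive (t : R) : is_derive t 1 num_z (num_z' t).
Proof.
have Dc := c_derive t; have Ds := s_derive t.
apply: (is_derive_eq (is_derive_fM (is_derive_fM (cst_derive (2 * k) t) Dc) Ds)).
rewrite /num_z'; ring.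
Qed.

Definition geodesic t : DR :=
  (((num_x t * (den t)^-1) *: x + (num_Jx t * (den t)^-1) *: (J z *m x),
    (num_z t * (den t)^-1) *: z), (den t)^-1).

Definition dquot (f df : R -> R) t := (df t * den t - f t * den' t) / den t ^+ 2.

Definition dgeodesic t : DR :=
  ((dquot num_x num_x' t *: x + dquot num_Jx num_Jx' t *: (J z *m x),
    dquot num_z num_z' t *: z), - den' t / den t ^+ 2).

Lemma quot_derive (f df : R -> R) (t : R) : is_derive t 1 f (df t) ->
  is_derive t 1 (fun t => f t * (den t)^-1) (dquot f df t).
Proof.
move=> Df; have D0 := lt0r_neq0 (den_gt0 t).
apply: (is_derive_eq (is_derive_fM Df (is_derive_fV D0 (den_derive t)))).
by rewrite /dquot; field.
Qed.

Lemma geodesic_derive (t : R) : is_derive t 1 geodesic (dgeodesic t).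
Proof.
have D0 := lt0r_neq0 (den_gt0 t).
apply: is_derive1_pair; last exact: is_derive_fV D0 (den_derive t).
apply: is_derive1_pair.
  apply: is_deriveD; apply: is_derive1_scalel; apply: quot_derive.
    exact: num_x_derive.
  exact: num_Jx_derive.
by apply: is_derive1_scalel; apply: quot_derive; exact: num_z_derive.
Qed.

Lemma geodesic_C1 : C1_arc geodesic.
Proof.
have cc (t : R) : {for t, continuous c} by exact/derivable_continuous1/ex_derive.
have sc (t : R) : {for t, continuous s} by exact/derivable_continuous1/ex_derive.
split.
- by move=> t; apply: ex_derive; exact: geodesic_derive.
- have -> : (fun t => 'D_1 geodesic t) = dgeodesic.
    by apply/funext => t; apply: derive_val; exact: geodesic_derive.
  move=> t; have D0 := lt0r_neq0 (den_gt0 t).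
  have Dc : {for t, continuous den} by apply: derivable_continuous1; apply: ex_derive; exact: den_derive.
  have Pc : {for t, continuous num_x} by apply: derivable_continuous1; apply: ex_derive; exact: num_x_derive.
  have Hc : {for t, continuous num_Jx} by apply: derivable_continuous1; apply: ex_derive; exact: num_Jx_derive.
  have Wc : {for t, continuous num_z} by apply: derivable_continuous1; apply: ex_derive; exact: num_z_derive.
  have dDc : {for t, continuous den'}.
    by repeat first [exact: cc | exact: sc | exact: continuous_fc | apply: continuous_fM
      | apply: continuous_fD | apply: continuous_fN ].
  have dPc : {for t, continuous num_x'}.
    by repeat first [exact: cc | exact: sc | exact: continuous_fc | apply: continuous_fM
      | apply: continuous_fD | apply: continuous_fN ].
  have dHc : {for t, continuous num_Jx'}.
    by repeat first [exact: cc | exact: sc | exact: continuous_fc | apply: continuous_fM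
      | apply: continuous_fD | apply: continuous_fN ].
  have dWc : {for t, continuous num_z'}.
    by repeat first [exact: cc | exact: sc | exact: continuous_fc | apply: continuous_fM
      | apply: continuous_fD | apply: continuous_fN ].
  have D2c : {for t, continuous (fun t => (den t ^+ 2)^-1)}.
    apply: continuous_fV; first by rewrite expf_neq0.
    exact: (continuous_fM Dc Dc).
  have qc f df : {for t, continuous f} -> {for t, continuous df} ->
      {for t, continuous (dquot f df)}.
    move=> fc dfc; apply: continuous_fM D2c.
    by apply: continuous_fB; apply: continuous_fM.
  suff : {for t, continuous dgeodesic} by [].
  have dDN : {for t, continuous (fun t => - den' t / den t ^+ 2)}.
    by apply: continuous_fM D2c; exact: continuous_fN.
  have Zc := continuous_scalel (v := z) (qc _ _ Wc dWc).
  have Xc : {for t, continuous (fun t => dquot num_x num_x' t *: x + dquot num_Jx num_Jx' t *: (J z *m x))}.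
    by apply: cvgD; apply: continuous_scalel; exact: qc.
  exact: (continuous_pair (continuous_pair Xc Zc) dDN).
- by move=> t _; rewrite /DRset /= invr_gt0 den_gt0.
Qed.

Lemma geodesic_speed t : metric J (geodesic t) (dgeodesic t) (dgeodesic t)
  = 4 * q * w ^+ 2.
Proof.
have Dp := den_gt0 t; have D0 := lt0r_neq0 Dp.
rewrite metricE; last by rewrite /DRset /= invr_gt0.
have I := geodesic_identity (c t) (s t) b q w k0.
cbv zeta in I; rewrite csK -zE -xE in I.
rewrite /= bracket_plane scalerA -scalerBl.
rewrite !(dotpDl, dotpDr, dotpZl, dotpZr) J_dot// [dotp x (_ *m _)]dotpC J_dot0//.
set B := dotp x x in I *; set Z := dotp z z in I *.
have {}I : den' t ^+ 2 * den t + ((num_x' t * den t - num_x t * den' t) ^+ 2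
   + (num_Jx' t * den t - num_Jx t * den' t) ^+ 2 * Z) * B
   + (num_z' t * den t - num_z t * den' t - 2^-1 * (num_x t * num_Jx' t - num_Jx t * num_x' t) * B) ^+ 2 * Z * den t
   = 4 * q * w ^+ 2 * den t ^+ 3.
  apply: etrans (etrans I _); last by rewrite /den; ring.
  by rewrite /den /num_x /num_Jx /num_z /den' /num_x' /num_Jx' /num_z'; ring.
apply: (mulIf (expf_neq0 3 D0)); rewrite -I /dquot.
by field.
Qed.

End Curve.

(** * The distance formula and the estimate *)

Section Distance.
Context {R : realType} {mu nu : nat} (J : {linear 'cV[R]_nu -> 'M[R]_mu}).
Hypothesis J_skew : forall z, (J z)^T = - J z.
Hypothesis J_orth : forall z, enorm z = 1 -> (J z)^T *m J z = 1%:M.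
Local Notation DR := (ambient R mu nu).
Local Notation F := (@cosh_dist R mu nu).

(** Here c = cosh (r (1 - t) / 2) and s = sinh (r (1 - t) / 2) / th, where
    th = tanh (r / 2): the ray is run through backwards, from its full length at
    t = 0, where s = c, to its origin at t = 1. *)
Lemma joined_dist_formula (p : DR) : punctured p ->
  joined J p (DRone mu nu) (dist_formula p).
Proof.
move=> pp; have [p0 p1] := pp; have a0 : 0 < p.2 := p0.
have an0 := lt0r_neq0 a0.
set rho := dist_formula p; have rho0 : 0 < rho := dist_formula_gt0 pp.
pose E := expR rho; have E1 : 1 < E by rewrite expR_gt1.
have En0 : E != 0 by rewrite lt0r_neq0// expR_gt0.
have E1n0 : E - 1 != 0 by rewrite subr_eq0 gt_eqF.
have E2n0 : E + 1 != 0 by rewrite lt0r_neq0// addr_gt0 ?expR_gt0.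
pose th := (E - 1) / (E + 1); have thn0 : th != 0 by rewrite mulf_neq0 ?invr_eq0.
have th0 : 0 < th by rewrite divr_gt0 ?subr_gt0// addr_gt0 ?expR_gt0.
pose q := th ^+ 2.
set B := dotp p.1.1 p.1.1; set Z := dotp p.1.2 p.1.2.
have B0 : 0 <= B by exact: dotp_ge0.
have Z0 : 0 <= Z by exact: dotp_ge0.
pose h := p.2 + B / 4; pose N := (1 + h) ^+ 2 + Z.
have h0 : 0 < h by rewrite ltr_wpDr// divr_ge0.
have N0 : 0 < N by rewrite ltr_wpDr// exprn_gt0// addr_gt0.
have Nn0 := lt0r_neq0 N0.
pose b := (h ^+ 2 - 1 + Z) / N; pose k := 2 / N.
have k0 : 0 < k by rewrite divr_gt0.
have kn0 := lt0r_neq0 k0.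
(* tanh (r / 2)^2 = (F - 1) / (F + 1) *)
have qE : q = ((h - 1) ^+ 2 + B + Z) / N.
  (* F = (E + 1 / E) / 2 *)
  have FE : 2 * F p * E = E ^+ 2 + 1.
    have ->: E = F p + sinh_dist p by rewrite /E expR_dist.
    have S := sinh_dist_sqr p0.
    transitivity (2 * F p ^+ 2 + 2 * F p * sinh_dist p); first by ring.
    transitivity (F p ^+ 2 + 2 * F p * sinh_dist p + sinh_dist p ^+ 2 + 1); last by ring.
    by rewrite S; ring.
  have FB : (F p - 1) * (2 * p.2) = (h - 1) ^+ 2 + B + Z.
    by rewrite cosh_distB1// -/B -/Z /h; field.
  have FN : (F p + 1) * (2 * p.2) = N.
    have -> : F p + 1 = (F p - 1) + 2 by ring.
    by rewrite mulrDl FB /N /h; field.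
  apply: (mulIf Nn0); rewrite divfK// -FB -FN.
  apply: (mulIf En0); rewrite /q /th.
  have -> : (F p - 1) * (2 * p.2) * E = (2 * F p * E - 2 * E) * p.2 by ring.
  have -> : ((E - 1) / (E + 1)) ^+ 2 * ((F p + 1) * (2 * p.2)) * E =
    ((E - 1) / (E + 1)) ^+ 2 * (2 * F p * E + 2 * E) * p.2 by ring.
  by rewrite FE; field.
pose m := 2 * k + 2 * b - 1.
have zE : dotp p.1.2 p.1.2 = (m - b ^+ 2) / k ^+ 2.
  by rewrite -/Z /m /b /k /N; field; rewrite -/N Nn0.
have xE : dotp p.1.1 p.1.1 = 2 * (q - m) / k.
  by rewrite -/B qE /m /b /k; have -> : Z = N - (1 + h) ^+ 2 by [rewrite /N; ring]; field.
have mq : m <= q.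
  have : q - m = B * k / 2 by rewrite /B xE; field.
  have : 0 <= B * k / 2 by rewrite divr_ge0// mulr_ge0// ltW.
  lra.
pose e t := expR (rho / 2 + (- (rho / 2)) * t).
have en0 t : e t != 0 by rewrite lt0r_neq0// expR_gt0.
pose c t := 2^-1 * (e t + (e t)^-1).
pose s t := (2 * th)^-1 * (e t + -1 * (e t)^-1).
pose w := - (rho / (2 * th)).
have csK t : c t * c t - q * s t * s t = 1.
  by rewrite /c /s /q; field; rewrite thn0 en0.
have de (t : R) : is_derive t 1 e (- (rho / 2) * e t).
  have dc (r : R) : is_derive t 1 (fun=> r : R) 0 by exact: is_derive_cst.
  have di : is_derive t 1 (fun r : R => r) 1 by exact: is_derive_id.
  have D := is_derive_fD (dc (rho / 2)) (is_derive_fM (dc (- (rho / 2))) di).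
  apply: (is_derive_eq (is_derive1_comp (g := fun t => rho / 2 + (- (rho / 2)) * t) (is_derive_expR _) D)).
  by rewrite -/(e t) /GRing.scale/=; ring.
have dcs (t r r' : R) : is_derive t 1 (fun t => r * (e t + r' * (e t)^-1))
    (r * (- (rho / 2) * e t + r' * (rho / 2 / e t))).
  have dc (u : R) : is_derive t 1 (fun=> u : R) 0 by exact: is_derive_cst.
  apply: (is_derive_eq (is_derive_fM (dc r) (is_derive_fD (de t)
    (is_derive_fM (dc r') (is_derive_fV (en0 t) (de t)))))).
  by field; exact: en0.
have cD (t : R) : is_derive t 1 c (w * q * s t).
  have -> : c = fun t => 2^-1 * (e t + 1 * (e t)^-1).
    by apply/funext => u; rewrite mul1r.
  apply: (is_derive_eq (dcs t 2^-1 1)).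
  by rewrite /w /q /s; field; rewrite thn0 en0.
have sD (t : R) : is_derive t 1 s (w * c t).
  apply: (is_derive_eq (dcs t (2 * th)^-1 (-1))).
  by rewrite /w /c; field; rewrite thn0 en0.
pose g := geodesic J p.1.1 p.1.2 k b c s.
have gC1 : C1_arc g by exact: (geodesic_C1 _ _ kn0 zE mq csK cD sD).
have gL : arc_length J g = rho.
  rewrite /arc_length.
  have -> : speed J g = fun=> rho.
    apply/funext => t; rewrite /speed.
    have -> : 'D_1 g t = dgeodesic J p.1.1 p.1.2 k b q w c s t.
      by apply: derive_val; apply: geodesic_derive.
    rewrite (geodesic_speed J_skew J_orth w kn0 zE xE mq csK).
    have -> : 4 * q * w ^+ 2 = rho ^+ 2 by rewrite /q /w; field.
    by rewrite sqrtr_sqr gtr0_norm.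
  by rewrite Rintegral_cst//= lebesgue_measure_itv/= lte_fin ltr01 oppr0 adde0 mulr1.
have g1 : g 1 = DRone mu nu.
  have e1 : e 1 = 1 by rewrite /e mulr1 subrr expR0.
  have c1 : c 1 = 1 by rewrite /c e1 invr1; field.
  have s1 : s 1 = 0 by rewrite /s e1 invr1; ring.
  rewrite /g /geodesic /num_x /num_Jx /num_z /den c1 s1 !(mulr0, mul0r, addr0, scale0r, mulr1).
  by rewrite invr1.
have g0 : g 0 = p.
  have e0 : e 0 ^+ 2 = E.
    by rewrite /e mulr0 addr0 -expRM_natl; congr expR; field.
  have s0 : s 0 = c 0.
    rewrite /s /c /th -e0.
    have A1 : e 0 ^+ 2 + 1 != 0 by rewrite e0.
    have A2 : e 0 ^+ 2 - 1 != 0 by rewrite e0.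
    by field; rewrite en0 A1 A2.
  have c0 : c 0 != 0.
    by rewrite lt0r_neq0// mulr_gt0// addr_gt0 ?invr_gt0 ?expR_gt0.
  have cq : c 0 * c 0 * (1 - q) = 1 by apply: etrans (csK 0); rewrite s0; ring.
  have DE : den k b c s 0 = c 0 * c 0 * (2 * k) by rewrite /den s0; ring.
  have PE : num_x k b c s 0 = c 0 * c 0 * (2 * k) by rewrite /num_x s0; ring.
  have HE : num_Jx k c s 0 = 0 by rewrite /num_Jx s0; ring.
  have WE : num_z k c s 0 = c 0 * c 0 * (2 * k) by rewrite /num_z s0; ring.
  have Dn0 : c 0 * c 0 * (2 * k) != 0 by apply: mulf_neq0; apply: mulf_neq0; rewrite ?pnatr_eq0.
  rewrite /g /geodesic DE PE HE WE divff// mul0r scale0r addr0 !scale1r.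
  have -> : (c 0 * c 0 * (2 * k))^-1 = p.2.
    apply: (mulIf Dn0); rewrite mulVf//.
    have <- : c 0 * c 0 * (1 - q) = p.2 * (c 0 * c 0 * (2 * k)).
      have -> : 1 - q = p.2 * (2 * k).
        have ZN : Z = N - (1 + h) ^+ 2 by rewrite /N; ring.
        have BE : B = 4 * (h - p.2) by rewrite /h; field.
        by rewrite qE ZN BE /k; field.
      by ring.
    by rewrite cq.
  by case: (p) => [[]].
by rewrite -gL -g0 -g1; exact: joined_arc.
Qed.

Lemma DRrE (p : DR) : punctured p -> DRr J p = dist_formula p.
Proof.
move=> pp; have J1 := joined_dist_formula pp.
have lb : lbound [set l | joined J p (DRone mu nu) l] (dist_formula p).
  move=> l /= /(dist_formula_joined J_skew J_orth); rewrite dist_formula1 add0r //.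
apply/eqP; rewrite eq_le; apply/andP; split.
  by apply: ge_inf => //; exists (dist_formula p).
by apply: lb_le_inf => //; exists (dist_formula p).
Qed.

End Distance.

Theorem theorem1p3 (R : realType) (mu nu : nat)
    (J : {linear 'cV[R]_nu -> 'M[R]_mu})
    (nu_ge1 : (1 <= nu)%N)
    (J_skew : forall z, (J z)^T = - J z)
    (J_orth : forall z, enorm z = 1 -> (J z)^T *m J z = 1%:M)
    (k : nat) (k_ge1 : (1 <= k)%N) :
  exists2 C : R, 0 < C &
    forall (I : k.-tuple 'I_(1 + (mu + nu))) (p : ambient R mu nu),
      DRset p -> p <> DRone mu nu ->
      (forall i : nat, (1 <= i <= k)%N ->
         differentiable (frame_derives J (drop i I) (DRr J)) p) /\
      `|frame_derives J I (DRr J) p| <=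
        C * ((1 + DRr J p) / DRr J p) ^+ (k - 1).
Proof.
have rE s (p : ambient R mu nu) : punctured p ->
    frame_derives J s (DRr J) p = frame_derives J s (@dist_formula R mu nu) p.
  elim: s p => [|i s IH] p pp /=; first exact: DRrE.
  apply: frame_derive_near.
  by apply: filterS (near_punctured pp) => q; exact: IH.
have sym s (i : 'I_(1 + (mu + nu))) := symbol_frame_derives_dist J s i.
have B (I : k.-tuple 'I_(1 + (mu + nu))) : exists C : R, 0 <= C /\
    forall p, punctured p -> `|frame_derives J I (@dist_formula R mu nu) p| <=
      C * ((1 + dist_formula p) / dist_formula p) ^+ (k - 1).
  have sI := size_tuple I; case/lastP: (tval I) sI => [|s i] sI.
    by rewrite -sI in k_ge1.
  have ks : (k - 1 = size s)%N by rewrite -sI size_rcons subn1.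
  have [C C0 fC] := symbol_bound J_skew J_orth (sym s i); exists C; split=> // p pp.
  rewrite (le_trans (fC _ pp))// ks ler_wpM2l// lerXn2r ?nnegrE ?coth_dist_le//.
    have [p0 p1] := pp; rewrite divr_ge0 ?sqrtr_ge0//; exact/ltW/cosh_dist_gt0.
  by have r0 := ltW (dist_formula_gt0 pp); rewrite divr_ge0// addr_ge0.
have [C CB] := choice B.
(* There are finitely many words of length k. *)
exists (1 + \sum_I C I) => [|I p p0 pe].
  by rewrite ltr_wpDr// sumr_ge0// => I _; have [] := CB I.
have pp : punctured p by split=> //; exact: cosh_dist_gt1.
split=> [i /andP[i1 ik]|].
  apply: (near_differentiable (f := frame_derives J (drop i I) (@dist_formula R mu nu))).
    by apply: filterS (near_punctured pp) => q qp; rewrite rE.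
  case/lastP: (drop i I) => [|s j].
    by have [] := is_derive_dist_formula 0 pp.
  exact: symbol_differentiable (sym s j) p pp.
rewrite rE// DRrE//; have [C0 CI] := CB I.
apply: le_trans (CI _ pp) _; rewrite ler_wpM2r//.
  have r0 := ltW (dist_formula_gt0 pp).
  by rewrite exprn_ge0// divr_ge0// addr_ge0.
rewrite (bigD1 I)//= addrCA lerDl addr_ge0// sumr_ge0// => I' _.
by have [] := CB I'.
Qed.
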